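(* Let $\mathfrak g$ be an untwisted affine Kac--Moody Lie algebra and let $\lambda\in\mathcal P^+$ be regular dominant with $\langle\lambda,d\rangle=0$. Then the dominant weight polyhedron $D_\lambda$ decomposes as $$D_\lambda=\operatorname{conv}_{\mathbb Q}\left(\{\hat b_J(\lambda)\}_{J\subsetneq I}\right)+\mathbb Q_+(-\delta),$$ where $J$ ranges over all proper subsets of $I$ (including $\varnothing$) and $+$ denotes Minkowski sum.
   Context: $\mathfrak g$ is the untwisted affine Kac--Moody Lie algebra (conventions of Kac's book) of a finite-dimensional simple complex Lie algebra of rank $l$, with Cartan subalgebra $\mathfrak h$, derivation $d\in\mathfrak h$, $I=\{0,1,\dots,l\}$, simple roots $\alpha_i$, simple coroots $\alpha_i^\vee$, simple reflections $s_i$ generating the Weyl group $W$, basic imaginary root $\delta$. $\mathbb Q_+$ denotes the nonnegative rationals. $\mathcal P^+=\{\lambda\in\mathfrak h^*:\langle\lambda,\alpha_i^\vee\rangle\in\mathbb Z_{\ge0}\ \forall i\in I\}$; $\lambda$ is regular dominant if $\langle\lambda,\alpha_i^\vee\rangle>0$ for all $i\in I$. Fundamental weights: $\langle\Lambda_i,\alpha_j^\vee\rangle=\delta_{ij}$, $\langle\Lambda_i,d\rangle=0$. $\mathfrak h^*_{\mathbb Q}=\bigoplus_{i\in I}\mathbb Q\Lambda_i\oplus\mathbb Q\delta$, and $\mathcal C_{\mathbb Q}=\{\mu\in\mathfrak h^*_{\mathbb Q}:\langle\mu,\alpha_i^\vee\rangle\ge0\ \forall i\in I\}$. Dominant weight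 polyhedron: $D_\lambda=\mathcal C_{\mathbb Q}\cap\operatorname{conv}_{\mathbb Q}\{w\lambda:w\in W\}$, where $\operatorname{conv}_{\mathbb Q}$ is the rational convex hull. For $J\subsetneq I$, $W_J=\langle s_j:j\in J\rangle\subset W$ (a finite group) and $\hat b_J(\lambda)=\frac1{|W_J|}\sum_{w\in W_J}w(\lambda)$. *)

(* Defs.v *)
From HB Require Import structures.
From mathcomp Require Import all_boot all_order all_algebra finmap.
From mathcomp Require Import boolp classical_sets functions cardinality reals.
From mathcomp Require Import complex.

Set Implicit Arguments.
Unset Strict Implicit.
Unset Printing Implicit Defensive.

Import Order.TTheory GRing.Theory Num.Theory.
Local Open Scope classical_set_scope.
Local Open Scope ring_scope.

(** ** The finite-dimensional simple Lie algebra, through its Cartan matrix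

Convention (Kac): [A i j] is the pairing of the simple root [alpha_j] with the
simple coroot [alpha_i^vee].  Elements of the root (resp. coroot) lattice are
column vectors of coordinates on the simple roots (resp. simple coroots). *)

Definition generalized_cartan l (A : 'M[int]_l) : Prop :=
  [/\ forall i, A i i = 2,
      forall i j, i != j -> A i j <= 0 &
      forall i j, A i j = 0 -> A j i = 0].

Definition indecomposable l (A : 'M[int]_l) : Prop :=
  forall S : {set 'I_l}, S != finset.set0 -> S \proper [set: 'I_l]%SET ->
    exists i j, [/\ i \in S, j \notin S & A i j != 0].

(** Symmetrizable, with positive definite symmetrization. *)
Definition finite_type l (A : 'M[int]_l) : Prop :=
  exists e : 'rV[rat]_l,
    let B := diag_mx e *m map_mx intr A in
    [/\ forall i, 0 < e 0 i,
        B^T = B &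
        forall x : 'cV[rat]_l, x != 0 -> 0 < (x^T *m B *m x) 0 0].

Definition simple_cartan l (A : 'M[int]_l) : Prop :=
  [/\ (0 < l)%N, generalized_cartan A, indecomposable A & finite_type A].

(** [root_coroot A b c]: [b] is a root and [c] is its coroot; if
[b = w alpha_j] with [w] in the Weyl group, then [c = w alpha_j^vee]. *)
Inductive root_coroot l (A : 'M[int]_l) : 'cV[int]_l -> 'cV[int]_l -> Prop :=
| RootSimple j : root_coroot A (delta_mx j 0) (delta_mx j 0)
| RootRefl i b c : root_coroot A b c ->
    root_coroot A (b - (A *m b) i 0 *: delta_mx i 0)
                  (c - (A^T *m c) i 0 *: delta_mx i 0).

Definition highest_root l (A : 'M[int]_l) (th thv : 'cV[int]_l) : Prop :=
  root_coroot A th thv /\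
  forall b c, root_coroot A b c -> forall i, b i 0 <= th i 0.

(** Index 0 is the affine node: [alpha_0 = delta - theta] and
[alpha_0^vee = K - theta^vee] with [K] central. *)
Definition extended_cartan l (A : 'M[int]_l) (th thv : 'cV[int]_l) :
    'M[int]_(1 + l) :=
  block_mx 2%:M (- (thv^T *m A)) (- (A *m th)) A.

(** ** The untwisted affine Kac-Moody algebra

Only the part of the algebra visible in the weight space is recorded: the
extended Cartan matrix and a realization of it, with the derivation [der] and
the fundamental weights determined by it.  [hspace] is the Cartan subalgebra;
its dimension [l + 2] is [2 n - rank] for the extended matrix, of size
[n = l + 1] and rank [l]. *)

Record untwisted_affine (C : numClosedFieldType) (l : nat) := UntwistedAffine {
  fin_cartan : 'M[int]_l;
  theta : 'cV[int]_l;
  thetav : 'cV[int]_l;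
  fin_cartanP : simple_cartan fin_cartan;
  thetaP : highest_root fin_cartan theta thetav;
  hspace : vectType C;
  alpha : 'I_(1 + l) -> 'Hom(hspace, C^o);
  alphav : 'I_(1 + l) -> hspace;
  dim_h : \dim {: hspace} = l.+2;
  alpha_free : free [seq alpha i | i <- enum 'I_(1 + l)];
  alphav_free : free [seq alphav i | i <- enum 'I_(1 + l)];
  alphaE : forall i j,
    alpha j (alphav i) = (extended_cartan fin_cartan theta thetav i j)%:~R;
  der : hspace;
  alpha_d : forall i, alpha i der = (i == ord0)%:R;
  Lambda : 'I_(1 + l) -> 'Hom(hspace, C^o);
  LambdaE : forall i j, Lambda i (alphav j) = (i == j)%:R;
  Lambda_d : forall i, Lambda i der = 0
}.

Section Weights.
Variables (C : numClosedFieldType) (l : nat) (g : untwisted_affine C l).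

Definition hdual : vectType C := 'Hom(hspace g, C^o).

(** [delta = alpha_0 + theta]: the marks of an untwisted affine diagram are 1
at the affine node and the coordinates of [theta] elsewhere. *)
Definition delta : hdual :=
  alpha g ord0 + \sum_(i < l) (theta g i 0)%:~R *: alpha g (rshift 1 i).

Definition srefl (i : 'I_(1 + l)) : 'End(hdual) :=
  linfun (fun mu : hdual => mu - (mu (alphav g i) : C) *: alpha g i).

(** The subgroup generated by the [s_j], [j \in J], in the linear automorphism
group of [hdual]. *)
Inductive weyl (J : {set 'I_(1 + l)}) : set 'End(hdual) :=
| weyl_refl j : j \in J -> weyl J (srefl j)
| weyl_id : weyl J \1%VF
| weyl_comp u v : weyl J u -> weyl J v -> weyl J (u \o v)%VF
| weyl_inv u : weyl J u -> weyl J (u^-1)%VF.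

Definition W : set 'End(hdual) := weyl [set: 'I_(1 + l)]%SET.

Definition dominant_integral : set hdual :=
  [set mu | forall i, exists n : nat, mu (alphav g i) = n%:R].

Definition regular_dominant (mu : hdual) : Prop :=
  forall i, 0 < (mu (alphav g i) : C).

Definition hdualQ : set hdual :=
  [set mu | exists (x : 'I_(1 + l) -> rat) (q : rat),
     mu = \sum_i ratr (x i) *: Lambda g i + ratr q *: delta].

Definition chamberQ : set hdual :=
  [set mu | hdualQ mu /\ forall i, 0 <= (mu (alphav g i) : C)].

Definition convQ (S : set hdual) : set hdual :=
  [set mu | exists n (c : 'I_n -> rat) (v : 'I_n -> hdual),
     [/\ forall k, 0 <= c k, \sum_k c k = 1, forall k, S (v k) &
         mu = \sum_k ratr (c k) *: v k]].

Definition coneQ (nu : hdual) : set hdual :=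
  [set ratr q *: nu | q in [set q : rat | 0 <= q]].

Definition minkowski (X Y : set hdual) : set hdual :=
  [set x + y | x in X & y in Y].

Definition dominant_polyhedron (mu : hdual) : set hdual :=
  chamberQ `&` convQ [set (w : 'End(hdual)) mu | w in W].

(** [weyl J] is finite when [J] is proper ([fset_set] of an infinite set would
be empty). *)
Definition bhat (J : {set 'I_(1 + l)}) (mu : hdual) : hdual :=
  (#|` fset_set (weyl J)|%fset%:R)^-1 *: \sum_(w <- fset_set (weyl J)) w mu.

Lemma sreflE i (mu : hdual) :
  srefl i mu = mu - (mu (alphav g i) : C) *: alpha g i.
Proof.
pose f (nu : hdual) : hdual := nu - (nu (alphav g i) : C) *: alpha g i.
have lin : linear f.
  move=> a u v; rewrite /f add_lfunE scale_lfunE.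
  by rewrite scalerDl scalerBr scalerA opprD addrACA.
pose F := HB.pack_for {linear hdual -> hdual} f
  (GRing.isLinear.Build C hdual hdual *:%R f lin).
exact: (lfunE F mu).
Qed.

End Weights.

(* Main.v *)
(** Write a weight below [lambda] as [lambda - sum_i c_i alpha_i].  Every point
of the convex hull of the orbit has [c >= 0], because [w lambda <= lambda]: real
roots are sign-coherent (by positive semidefiniteness of the symmetrized affine
Cartan matrix [A] and integrality), which gives the exchange condition.
Dominance is [A c <= b], where [b_i = <lambda, alpha_i^vee> > 0].  For a fixed
[i] the inequalities [c_i >= 0] and [(A c)_i <= b_i] cannot both be tight, so
moving along edges shows that the polyhedron they define is the convex hull of
the solutions of [c_i = 0] ([i \notin J]), [(A c)_j = b_j] ([j \in J]), [J]
proper, plus the ray spanned by the marks, i.e. by [delta].  These solutions are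
the coordinates of [bhat J lambda], which is [W_J]-invariant.  Conversely,
averaging the images of [lambda] under the translations by [theta] and [-theta]
shows that the convex hull of the orbit is stable under [- delta]. *)
Require Import Defs.
From mathcomp Require Import all_boot all_order all_algebra archimedean finmap.
From mathcomp Require Import boolp classical_sets cardinality.
From mathcomp Require Import reals complex.
From mathcomp Require Import ring lra zify.

Set Implicit Arguments.
Unset Strict Implicit.
Unset Printing Implicit Defensive.

Import Order.TTheory GRing.Theory Num.Theory.
Local Open Scope ring_scope.

Lemma sub_deltaE (R : nzRingType) n (x : 'cV[R]_n) t i k :
  (x - t *: delta_mx i 0) k 0 = x k 0 - t * (k == i)%:R.
Proof. by rewrite !mxE eqxx andbT. Qed.

(** * The symmetrized form of an affine matrix *)

Section Form.
Variables (n : nat) (A : 'M[rat]_n) (e : 'I_n -> rat).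
Implicit Types (x y z : 'cV[rat]_n) (i j : 'I_n) (J : {set 'I_n}).

Definition form x y : rat := \sum_i e i * x i 0 * (A *m y) i 0.

Definition supported J x := forall i, i \notin J -> x i 0 = 0.

(** Collects what the combinatorial part uses of an affine Cartan matrix: [e] symmetrizes it, and
    the form is positive semidefinite with its isotropic vectors on the line of the marks [a], the
    coordinates of [delta]. *)
Record affine_matrix (a : 'cV[rat]_n) : Prop := AffineMatrix {
  affine_int : forall i j, A i j \is a Num.int;
  affine_diag : forall i, A i i = 2;
  affine_off : forall i j, i != j -> A i j <= 0;
  affine_e_gt0 : forall i, 0 < e i;
  affine_sym : forall i j, e i * A i j = e j * A j i;
  affine_psd : forall x, 0 <= form x x;
  affine_null : forall x, form x x = 0 -> exists t, x = t *: a;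
  affine_mark_gt0 : forall i, 0 < a i 0;
  affine_mark0 : A *m a = 0
}.

Variable a : 'cV[rat]_n.
Hypothesis aff : affine_matrix a.

Lemma formDr x y z : form x (y + z) = form x y + form x z.
Proof.
rewrite /form -big_split; apply: eq_bigr => i _.
by rewrite mulmxDr mxE mulrDr.
Qed.

Lemma formZr t x y : form x (t *: y) = t * form x y.
Proof.
rewrite /form mulr_sumr; apply: eq_bigr => i _.
by rewrite -scalemxAr mxE mulrCA.
Qed.

Lemma formC x y : form x y = form y x.
Proof.
rewrite /form; under eq_bigr do rewrite mxE mulr_sumr.
under [RHS]eq_bigr do rewrite mxE mulr_sumr.
rewrite exchange_big; apply: eq_bigr => i _; apply: eq_bigr => j _.
transitivity (e j * A j i * (x j 0 * y i 0)); first by ring.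
by rewrite (affine_sym aff); ring.
Qed.

Lemma formDl x y z : form (x + y) z = form x z + form y z.
Proof. by rewrite formC formDr !(formC z). Qed.

Lemma formZl t x y : form (t *: x) y = t * form x y.
Proof. by rewrite formC formZr formC. Qed.

Lemma form_marks x : form a x = 0.
Proof.
rewrite formC /form (affine_mark0 aff).
by apply: big1 => i _; rewrite mxE mulr0.
Qed.

Lemma form_unit i x : form (delta_mx i 0) x = e i * (A *m x) i 0.
Proof.
rewrite /form (bigD1 i) //= mxE !eqxx mulr1 big1 ?addr0 // => k ki.
by rewrite mxE (negPf ki) mulr0 mul0r.
Qed.

Lemma mulmx_unit i j : (A *m delta_mx j 0 : 'cV__) i 0 = A i j.
Proof. by rewrite -colE mxE. Qed.

(** Isotropic vectors are multiples of the marks, and no mark vanishes. *)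
Lemma form_eq0 x i : form x x = 0 -> x i 0 = 0 -> x = 0.
Proof.
move=> /(affine_null aff)[t ->]; rewrite mxE => /eqP.
rewrite mulf_eq0 (gt_eqF (affine_mark_gt0 aff i)) orbF => /eqP ->.
by rewrite scale0r.
Qed.

Lemma proper_notin J : J \proper [set: 'I_n] -> exists i, i \notin J.
Proof. by case/properP => _ [i _ iJ]; exists i. Qed.

Lemma supported_form_eq0 J x : J \proper [set: 'I_n] -> supported J x ->
  form x x = 0 -> x = 0.
Proof. by move=> /proper_notin[i iJ] sx x0; apply: form_eq0 x0 (sx i iJ). Qed.

Lemma supported_kernel J x : J \proper [set: 'I_n] -> supported J x ->
  (forall j, j \in J -> (A *m x) j 0 = 0) -> x = 0.
Proof.
move=> Jp sx Ax; apply: (supported_form_eq0 Jp sx).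
rewrite /form big1 // => i _; case: (boolP (i \in J)) => iJ.
  by rewrite Ax ?mulr0.
by rewrite sx // mulr0 mul0r.
Qed.

Lemma supported_solution J (b : 'cV[rat]_n) : J \proper [set: 'I_n] ->
  exists2 x, supported J x & forall j, j \in J -> (A *m x) j 0 = b j 0.
Proof.
move=> Jp.
(* Completing the rows of [J] by identity rows makes the system square; [supported_kernel] gives its
   injectivity. *)
pose M : 'M[rat]_n := \matrix_(i, j) if i \in J then A i j else (i == j)%:R.
have ME (x : 'cV_n) i : (M *m x) i 0 = if i \in J then (A *m x) i 0 else x i 0.
  rewrite !mxE; case: ifP => iJ.
    by apply: eq_bigr => j _; rewrite !mxE iJ.
  rewrite (bigD1 i) //= !mxE iJ eqxx mul1r big1 ?addr0 // => j ji.
  by rewrite mxE iJ eq_sym (negPf ji) mul0r.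
have Mu : M \in unitmx.
  rewrite -unitmx_tr unitmxE unitfE; apply/negP => /det0P[v v0 vM].
  have {}vM : M *m v^T = 0 by apply: trmx_inj; rewrite trmx_mul trmxK trmx0.
  case/eqP: v0; apply: trmx_inj; rewrite trmx0; apply: (supported_kernel Jp).
    by move=> i iJ; have := ME v^T i; rewrite vM (negPf iJ) mxE => <-.
  by move=> i iJ; have := ME v^T i; rewrite vM iJ mxE => <-.
pose b' : 'cV_n := \col_i if i \in J then b i 0 else 0.
have xE : M *m (invmx M *m b') = b' by rewrite mulKVmx.
exists (invmx M *m b') => i iJ; have := ME (invmx M *m b') i; rewrite xE mxE.
  by rewrite (negPf iJ) => <-.
by rewrite iJ => <-.
Qed.

Definition posp x : 'cV[rat]_n := \col_i Num.max (x i 0) 0.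
Definition negp x : 'cV[rat]_n := \col_i Num.max (- x i 0) 0.

Lemma posp_negp x : x = posp x - negp x.
Proof.
apply/matrixP => i j; rewrite ord1 !mxE.
by case: (lerP (x i 0) 0); case: (lerP (- x i 0) 0) => *; lra.
Qed.

Lemma negp_eq0 x : negp x = 0 -> forall i, 0 <= x i 0.
Proof.
move=> x0 i; have := congr1 (fun m : 'cV_n => m i 0) x0; rewrite !mxE => h.
by rewrite -oppr_le0 -[leRHS]h le_max lexx.
Qed.

Lemma posp_eq0 x : posp x = 0 -> forall i, x i 0 <= 0.
Proof.
move=> x0 i; have := congr1 (fun m : 'cV_n => m i 0) x0; rewrite !mxE => h.
by rewrite -[leRHS]h le_max lexx.
Qed.

(** The two parts have disjoint supports, so only off-diagonal entries of [A] contribute, and these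
    are nonpositive. *)
Lemma form_posp_negp x : form (posp x) (negp x) <= 0.
Proof.
rewrite /form; apply: sumr_le0 => i _; rewrite !mxE mulr_sumr.
apply: sumr_le0 => j _; rewrite !mxE -!mulrA.
rewrite pmulr_rle0 ?(affine_e_gt0 aff) //.
case: (eqVneq i j) => [<-|ij].
  suff -> : Num.max (x i 0) 0 * (A i i * Num.max (- x i 0) 0) = 0 by [].
  by case: (lerP (x i 0) 0) => h; rewrite ?mul0r // max_r ?mulr0 ?mulr0 //; lra.
apply: mulr_ge0_le0; first by rewrite le_max lexx orbT.
by apply: mulr_le0_ge0; [exact: (affine_off aff) | rewrite le_max lexx orbT].
Qed.

Lemma form_split x :
  form (posp x) (posp x) + form (negp x) (negp x) <= form x x.
Proof.
have := form_posp_negp x.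
rewrite {7 8}(posp_negp x) -scaleN1r !(formDl, formDr, formZl, formZr).
by rewrite (formC (negp x) (posp x)); lra.
Qed.

(* The finite part of a Cartan matrix is a nonsingular M-matrix. *)
Lemma supported_ge0 J x : J \proper [set: 'I_n] -> supported J x ->
  (forall j, j \in J -> 0 <= (A *m x) j 0) -> forall i, 0 <= x i 0.
Proof.
move=> Jp sx Ax; apply: negp_eq0.
have sn : supported J (negp x) by move=> i /sx xi; rewrite mxE xi oppr0 maxxx.
apply: (supported_form_eq0 Jp sn).
have h : 0 <= form (negp x) x.
  apply: sumr_ge0 => i _; case: (boolP (i \in J)) => iJ.
    by rewrite !mulr_ge0 ?Ax ?(ltW (affine_e_gt0 aff i)) // mxE le_max lexx orbT.
  by rewrite sn // mulr0 mul0r.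
have := form_posp_negp x; have := affine_psd aff (negp x).
move: h; rewrite {2}(posp_negp x) -scaleN1r formDr formZr.
by rewrite (formC (negp x) (posp x)); lra.
Qed.

Lemma supported_mul_le0 J x i : supported J x -> (forall k, 0 <= x k 0) ->
  i \notin J -> (A *m x) i 0 <= 0.
Proof.
move=> sx x0 iJ; rewrite mxE; apply: sumr_le0 => j _.
case: (eqVneq i j) => [<-|ij]; first by rewrite sx // mulr0.
by rewrite mulr_le0_ge0 ?(affine_off aff).
Qed.

Lemma form_CauchySchwarz x y : form x y ^+ 2 <= form x x * form y y.
Proof.
have [y0|y0] := eqVneq (form y y) 0.
  have [t ->] := affine_null aff y0.
  by rewrite !formZr !(formC _ a) !form_marks !mulr0 expr0n.
have yp : 0 < form y y by rewrite lt_def y0 (affine_psd aff).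
(* The square length of this vector is [form y y * (form x x * form y y - form x y ^+ 2)]. *)
have := affine_psd aff (form y y *: x - form x y *: y).
rewrite -scaleN1r !(formDl, formDr, formZl, formZr) (formC y x).
move=> h; rewrite -subr_ge0 -(pmulr_rge0 _ yp); apply: le_trans h _.
rewrite le_eqVlt; apply/orP; left; apply/eqP; ring.
Qed.

(** Meant for real roots supported on [J], which have the square length [2 * e j] of a simple root;
    it will make [W_J] finite. A coordinate is a pairing with a dual vector [w], so Cauchy-Schwarz
    bounds it. *)
Lemma supported_coord_bound J : J \proper [set: 'I_n] ->
  exists N : nat, forall j x k, supported J x ->
    form x x = 2 * e j -> `|x k 0| <= N%:R.
Proof.
move=> Jp.
have bnd j k : exists N : nat, forall x, supported J x ->
    form x x = 2 * e j -> `|x k 0| <= N%:R.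
  case: (boolP (k \in J)) => kJ; last first.
    by exists 0%N => x sx _; rewrite sx // normr0.
  have [w sw Aw] := supported_solution (delta_mx k 0) Jp.
  pose X := (2 * e j * form w w) / e k ^+ 2.
  have X0 : 0 <= X.
    rewrite !mulr_ge0 ?invr_ge0 ?exprn_ge0 ?(affine_psd aff) //;
      exact: ltW (affine_e_gt0 aff _).
  (* [X] bounds the square of the coordinate, and [X + 1] exceeds the square root of [X]. *)
  exists (Num.bound (X + 1)) => x sx fx.
  have fxw : form x w = e k * x k 0.
    rewrite /form (bigD1 k) //= Aw // mxE !eqxx mulr1 big1 ?addr0 // => i ik.
    case: (boolP (i \in J)) => iJ; last by rewrite sx // mulr0 mul0r.
    by rewrite Aw // mxE (negPf ik) mulr0.
  have ek := affine_e_gt0 aff k.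
  have h : x k 0 ^+ 2 <= X.
    rewrite /X ler_pdivlMr ?exprn_gt0 // mulrC -exprMn -fxw -fx.
    exact: form_CauchySchwarz.
  have /ltW : X + 1 < (Num.bound (X + 1))%:R by rewrite archi_boundP // addr_ge0.
  apply: le_trans; move: h; rewrite -real_normK ?num_real //.
  by have := normr_ge0 (x k 0); set y := `|_|; nra.
have [N NP] := fin_all_exists (fun j => fin_all_exists (bnd j)).
exists (\max_j \max_k N j k)%N => j x k sx fx; apply: le_trans (NP j k x sx fx) _.
by rewrite ler_nat (leq_trans _ (leq_bigmax j)) // (leq_bigmax k).
Qed.

End Form.

(** * Reflections, real roots and the exchange condition *)

Lemma sum_symmetric (R : nzRingType) n (G : 'I_n -> 'I_n -> R) :
  (forall i j, G i j = G j i) ->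
  \sum_i \sum_j G i j =
  \sum_i G i i + 2 * \sum_(i < n) \sum_(j < n | (j < i)%N) G i j.
Proof.
move=> Gsym.
have h i : \sum_j G i j = G i i +
    (\sum_(j < n | (j < i)%N) G i j + \sum_(j < n | (i < j)%N) G i j).
  rewrite (bigD1 i) //=; congr (_ + _); rewrite (bigID (fun j : 'I_n => (j < i)%N)) /=.
  congr (_ + _); apply: eq_bigl => j; rewrite -val_eqE /=; by case: ltngtP.
under eq_bigr do rewrite h.
rewrite !big_split /=; congr (_ + _); rewrite mulr_natl mulr2n; congr (_ + _).
rewrite (exchange_big_dep predT) //=; apply: eq_bigr => i _.
by apply: eq_bigr => j _; rewrite Gsym.
Qed.

Section Reflections.
Variables (n : nat) (A : 'M[rat]_n) (e : 'I_n -> rat).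
Implicit Types (x y z : 'cV[rat]_n) (i j : 'I_n) (s : seq 'I_n).

Definition refl i x : 'cV[rat]_n := x - (A *m x) i 0 *: delta_mx i 0.

Definition rword s x : 'cV[rat]_n := foldr refl x s.

(* If [b] lists the values of a weight [lam] on the simple coroots, then [s_i]
   maps [lam - sum_j y_j alpha_j] to [lam - sum_j (arefl b i y)_j alpha_j]. *)
Definition arefl (b : 'cV[rat]_n) i y : 'cV[rat]_n :=
  y + (b i 0 - (A *m y) i 0) *: delta_mx i 0.

Definition aword b s y : 'cV[rat]_n := foldr (arefl b) y s.

Variable a : 'cV[rat]_n.
Hypothesis aff : affine_matrix A e a.
Notation form := (form A e).

Lemma reflE i x k : refl i x k 0 = x k 0 - (A *m x) i 0 * (k == i)%:R.
Proof. exact: sub_deltaE. Qed.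

Lemma form_refl i x y : form (refl i x) (refl i y) = form x y.
Proof.
rewrite /refl -!scaleNr !(formDl aff, formDr, formZl aff, formZr).
rewrite (formC aff x (delta_mx i 0)) !form_unit mulmx_unit (affine_diag aff); ring.
Qed.

Lemma form_rword s x y : form (rword s x) (rword s y) = form x y.
Proof. by elim: s => //= i s IH; rewrite form_refl. Qed.

Lemma rwordZ s t x : rword s (t *: x) = t *: rword s x.
Proof.
elim: s => //= i s ->; rewrite /refl -scalemxAr mxE scalerBr.
by rewrite scalerA.
Qed.

Lemma rword_supported (J : {set 'I_n}) s x :
  all (mem J) s -> supported J x -> supported J (rword s x).
Proof.
move=> sJ sx k kJ; elim: s sJ => [|i s IH] /=; first by move=> _; exact: sx.
case/andP => iJ /IH; rewrite reflE => ->.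
by case: eqP kJ => [->|]; rewrite ?[i \in J]iJ // mulr0 subr0.
Qed.

(** If [x] is a Weyl image of [alpha_i], the numbers [e k * x k 0 / e i] are the coordinates of its
    coroot on the simple coroots. *)
Definition integral_root i x := forall k,
  x k 0 \is a Num.int /\ e k * x k 0 / e i \is a Num.int.

Lemma integral_root_rword i s : integral_root i (rword s (delta_mx i 0)).
Proof.
have ei := lt0r_neq0 (affine_e_gt0 aff i).
elim: s => [|j s IH] /= k.
  rewrite !mxE eqxx andbT; case: eqP => [->|_].
    by rewrite mulr1 divff.
  by rewrite mulr0 mul0r.
rewrite reflE; set x := rword s _ in IH *.
case: eqP => [->|_]; last by rewrite mulr0 subr0.
rewrite mulr1; have [xj exj] := IH j; split.
  rewrite rpredB // mxE rpred_sum // => m _.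
  by rewrite rpredM ?(affine_int aff) //; case: (IH m).
rewrite mulrBr mulrBl rpredB // mxE mulr_sumr mulr_suml rpred_sum // => m _.
have -> : e j * (A j m * x m 0) / e i = A m j * (e m * x m 0 / e i).
  transitivity (e j * A j m * (x m 0 / e i)); first by ring.
  by rewrite (affine_sym aff); ring.
by rewrite rpredM ?(affine_int aff) //; have [] := IH m.
Qed.

(** Both the diagonal entries 2 and the pairing of symmetric off-diagonal terms supply the factor 2;
    what remains are products of root coordinates, coroot coordinates and entries of [A]. *)
Lemma integral_root_form i x : integral_root i x ->
  form x x / (2 * e i) \is a Num.int.
Proof.
move=> xi; have ei := lt0r_neq0 (affine_e_gt0 aff i).
rewrite /form; under eq_bigr do rewrite mxE mulr_sumr.
rewrite sum_symmetric; last first.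
  move=> k j; transitivity (e k * A k j * (x k 0 * x j 0)); first by ring.
  by rewrite (affine_sym aff); ring.
rewrite mulrDl rpredD //.
  rewrite mulr_suml rpred_sum // => k _; have [xk exk] := xi k.
  rewrite (affine_diag aff).
  have -> : e k * x k 0 * (2 * x k 0) / (2 * e i) = e k * x k 0 / e i * x k 0.
    by field.
  by rewrite rpredM.
rewrite -mulf_div divff // mul1r mulr_suml rpred_sum // => k _.
rewrite mulr_suml rpred_sum // => j _; have [xk exk] := xi k; have [xj exj] := xi j.
have -> : e k * x k 0 * (A k j * x j 0) / e i = e k * x k 0 / e i * (A k j * x j 0).
  by ring.
by rewrite rpredM // rpredM // (affine_int aff).
Qed.

Lemma integral_root_posp i x : integral_root i x -> integral_root i (posp x).
Proof. by move=> xi k; rewrite mxE; case: ltP => // _; rewrite mulr0 mul0r. Qed.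

Lemma integral_root_negp i x : integral_root i x -> integral_root i (negp x).
Proof.
move=> xi k; rewrite mxE; case: ltP => _; first by rewrite mulr0 mul0r.
by rewrite mulrN mulNr !rpredN.
Qed.

(* For the positive and negative parts [x+], [x-] of a real root [x], the
   integrality of the coordinates of [x] and of its coroot makes [form x+ x+]
   and [form x- x-] natural multiples of [form x x], while their sum is at most
   [form x x]; hence one of the parts is isotropic, i.e. a multiple of the
   marks. *)
Lemma root_sign i s (x := rword s (delta_mx i 0)) :
  (forall k, 0 <= x k 0) \/ (forall k, x k 0 <= 0).
Proof.
have xi : integral_root i x by exact: integral_root_rword.
have ei := affine_e_gt0 aff i.
have fx : form x x = 2 * e i.
  by rewrite form_rword form_unit mulmx_unit (affine_diag aff) mulrC.
have pint := integral_root_form (integral_root_posp xi).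
have nint := integral_root_form (integral_root_negp xi).
have p0 := affine_psd aff (posp x); have n0 := affine_psd aff (negp x).
have e2 : 0 < 2 * e i by rewrite mulr_gt0.
have ge2 y : 0 <= form y y -> form y y != 0 ->
    form y y / (2 * e i) \is a Num.int -> 2 * e i <= form y y.
  move=> y0 yn yi; have e2n := lt0r_neq0 e2.
  have := norm_intr_ge1 yi (mulf_neq0 yn (invr_neq0 e2n)).
  rewrite ger0_norm; last by rewrite divr_ge0 // ltW.
  by rewrite ler_pdivlMr // mul1r.
have [pz|pnz] := eqVneq (form (posp x) (posp x)) 0; last first.
  have [nz|nnz] := eqVneq (form (negp x) (negp x)) 0; last first.
    have := form_split aff x; rewrite fx => h.
    have h1 := ge2 _ p0 pnz pint; have h2 := ge2 _ n0 nnz nint.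
    by exfalso; move: h1 h2 h e2; clear; lra.
  (* A multiple of the marks is zero as soon as one coordinate vanishes; otherwise no coordinate
     vanishes, and all coordinates of [x] have the same sign. *)
  case: (pickP (fun k => negp x k 0 == 0)) => [k /eqP nk|nk].
    by left; apply: negp_eq0; exact: (form_eq0 aff nz nk).
  right => k; move: (nk k); rewrite mxE; case: (lerP (- x k 0) 0); first by rewrite eqxx.
  by move=> *; lra.
case: (pickP (fun k => posp x k 0 == 0)) => [k /eqP nk|nk].
  by right; apply: posp_eq0; exact: (form_eq0 aff pz nk).
left => k; move: (nk k); rewrite mxE; case: (lerP (x k 0) 0); first by rewrite eqxx.
by move=> *; lra.
Qed.

Lemma aword_cat b s1 s2 y : aword b (s1 ++ s2) y = aword b s1 (aword b s2 y).
Proof. exact: foldr_cat. Qed.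

Lemma areflD b i y v : arefl b i (y + v) = arefl b i y + refl i v.
Proof.
rewrite /arefl /refl mulmxDr mxE opprD addrA scalerDl scaleNr.
by rewrite addrACA.
Qed.

Lemma awordD b s y v : aword b s (y + v) = aword b s y + rword s v.
Proof. by elim: s => //= i s ->; exact: areflD. Qed.

(** The invariant form between the weight [lam - sum_j y_j alpha_j] and [v]: that weight has the
    values [b - A y] on the simple coroots, and [e k] rescales the k-th coroot to [alpha_k]. *)
Definition pairing (b y v : 'cV[rat]_n) : rat := \sum_k e k * v k 0 * (b - A *m y) k 0.

Lemma pairing_unit b y i t :
  pairing b y (t *: delta_mx i 0) = t * e i * (b i 0 - (A *m y) i 0).
Proof.
rewrite /pairing (bigD1 i) //= 2!mxE !eqxx mulr1 big1 ?addr0.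
  by rewrite !mxE (mulrC (e i)).
by move=> k ki; rewrite 2!mxE (negPf ki) mulr0 mulr0 mul0r.
Qed.

Lemma pairing_form b y v : pairing b y v = \sum_k e k * v k 0 * b k 0 - form v y.
Proof.
rewrite /pairing /form -sumrB; apply: eq_bigr => k _.
by rewrite mxE [X in _ + X]mxE mulrBr.
Qed.

Lemma pairing_refl b i y v : pairing b (arefl b i y) (refl i v) = pairing b y v.
Proof.
rewrite !pairing_form; have -> : \sum_k e k * refl i v k 0 * b k 0 =
    \sum_k e k * v k 0 * b k 0 - (A *m v) i 0 * e i * b i 0.
  under eq_bigr do rewrite reflE mulrBr mulrBl.
  rewrite sumrB; congr (_ - _); rewrite (bigD1 i) //= eqxx mulr1 big1 ?addr0.
    by rewrite (mulrC (e i)).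
  by move=> k /negPf ->; rewrite !mulr0 mul0r.
rewrite /refl /arefl -scaleNr !(formDl aff, formDr, formZl aff, formZr).
rewrite (formC aff v (delta_mx i 0)) !form_unit mulmx_unit (affine_diag aff); ring.
Qed.

Lemma pairing_word b s y v : pairing b (aword b s y) (rword s v) = pairing b y v.
Proof. by elim: s => //= i s IH; rewrite pairing_refl. Qed.

(** A word [w] sending [alpha_i] to a multiple of [alpha_j] conjugates [s_i] into [s_j]; this is
    stated as [s_j w s_i = w]. *)
Lemma exchange_step i j s t : rword s (delta_mx i 0) = t *: delta_mx j 0 ->
  forall b y, aword b (j :: s ++ [:: i]) y = aword b s y.
Proof.
move=> st b y; rewrite /= aword_cat /= [arefl b i y]/arefl awordD rwordZ st.
set k := b i 0 - _; set z := aword b s y.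
have ei := affine_e_gt0 aff i; have ej := affine_e_gt0 aff j.
have et : e i = t ^+ 2 * e j.
  have := form_rword s (delta_mx i 0) (delta_mx i 0); rewrite st.
  rewrite (formZl aff) formZr !form_unit !mulmx_unit !(affine_diag aff); lra.
have t0 : t != 0 by apply/eqP => t0; move: ei; rewrite et t0 expr0n mul0r ltxx.
(* The word preserves [pairing], so the value of the image weight on the coroot of [j] is determined
   by that of the weight of [y] on the coroot of [i]. *)
have kE : b j 0 - (A *m z) j 0 = t * k.
  have := pairing_word b s y (delta_mx i 0).
  rewrite st -[X in _ = pairing _ _ X]scale1r !pairing_unit -/z -/k mul1r et.
  by rewrite expr2 -!mulrA => /(mulfI t0); rewrite mulrCA => /(mulfI (lt0r_neq0 ej)).
rewrite /arefl; have -> : (A *m (z + k *: (t *: delta_mx j 0))) j 0 =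
    (A *m z) j 0 + k * (t * 2).
  rewrite mulmxDr -!scalemxAr mxE [X in _ + X]mxE [X in _ * X]mxE.
  by rewrite mulmx_unit (affine_diag aff).
rewrite opprD addrA kE -addrA scalerA -scalerDl.
have -> : k * t + (t * k - k * (t * 2)) = 0 by ring.
by rewrite scale0r addr0.
Qed.

(** Consider the letter [j] at which the image of [alpha_i] first fails to be nonnegative. By
    [root_sign] it becomes nonpositive, while [s_j] changes only the j-th coordinate; so the root
    just before was a multiple of [alpha_j], and the letters [j] and [i] cancel. *)
Lemma exchange i s : ~~ [forall k, 0 <= rword s (delta_mx i 0) k 0] ->
  exists2 s', (size s' < size s)%N &
    forall b y, aword b (rcons s i) y = aword b s' y.
Proof.
elim: s => [|j s IH] /= neg.
  by case/negP: neg; apply/forallP => k; rewrite mxE; case: (_ && _).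
have [/forallP pos|/IH[s' lt_s' s'E]] :=
  boolP [forall k, 0 <= rword s (delta_mx i 0) k 0].
- exists s => //.
  have [pos'|np] := root_sign i (j :: s).
    by case/negP: neg; apply/forallP.
  rewrite -cats1.
  apply: (@exchange_step _ _ _ (rword s (delta_mx i 0) j 0)).
  apply/matrixP => k k'; rewrite ord1 2!mxE eqxx andbT.
  case: eqP => [->|/eqP kj]; first by rewrite mulr1.
  have := np k; rewrite /= reflE (negPf kj) !mulr0 subr0 => h.
  by apply/eqP; rewrite eq_le h pos.
- by exists (j :: s'); rewrite /= ?ltnS // => b y; rewrite s'E.
Qed.

(* That is, [w lam <= lam] for a dominant weight [lam]. *)
Lemma aword_ge0 (b : 'cV[rat]_n) s : (forall i, 0 <= b i 0) ->
  forall k, 0 <= aword b s 0 k 0.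
Proof.
move=> b0; have [m] := ubnP (size s); elim: m s => // m IH s.
case/lastP: s => [|s i] lt_sm k; first by rewrite mxE.
rewrite size_rcons ltnS in lt_sm.
(* With [w] the word [s], [w s_i lam = w lam - b_i w alpha_i]: if [w alpha_i] is positive, the
   induction hypothesis for [s] suffices; if not, the word can be shortened. *)
have [/forallP pos|neg] := boolP [forall k, 0 <= rword s (delta_mx i 0) k 0].
- rewrite -cats1 aword_cat /= [arefl b i 0]/arefl mulmx0 mxE subr0.
  rewrite awordD rwordZ 2!mxE addr_ge0 ?mulr_ge0 //; exact: IH.
- have [s' lt_s' ->] := exchange neg.
  by apply: IH; apply: leq_trans lt_s' _; apply: ltnW.
Qed.

End Reflections.

(** * Vertices and recession directions of the polyhedron *)

Lemma first_hit (F : realFieldType) (T : finType) (f g : T -> F) :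
  (forall k, 0 <= f k) -> (forall k, f k = 0 -> g k = 0) ->
  (exists k, g k < 0) ->
  exists t, [/\ 0 < t, forall k, 0 <= f k + t * g k &
                exists2 k, f k != 0 & f k + t * g k = 0].
Proof.
move=> f0 fg [k0 gk0].
(* The first constraint hit minimizes [f k / - g k] over the decreasing ones; the minimum is
   positive because constraints already tight stay constant. *)
case: (@arg_minP _ _ _ k0 (fun k => g k < 0) (fun k => f k / - g k) gk0) => k gk kmin.
have fk : f k != 0 by apply/eqP => /fg gk0'; rewrite gk0' ltxx in gk.
have gk' : g k != 0 by rewrite lt_eqF.
exists (f k / - g k); split.
- by rewrite divr_gt0 ?oppr_gt0 // lt_def fk f0.
- move=> j; case: (ltP (g j) 0) => gj; last first.
    by rewrite addr_ge0 // mulr_ge0 // divr_ge0 ?f0 // oppr_ge0 ltW.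
  have := kmin j gj; rewrite ler_pdivlMr ?oppr_gt0 // mulrN; lra.
- by exists k => //; field; rewrite gk'.
Qed.

Section Polyhedron.
Variables (n : nat) (A : 'M[rat]_n) (e : 'I_n -> rat) (a : 'cV[rat]_n).
Hypothesis aff : affine_matrix A e a.
Variable b : 'cV[rat]_n.
Hypothesis b_gt0 : forall i, 0 < b i 0.
Hypothesis n_gt0 : (0 < n)%N.
Variable vertex : {set 'I_n} -> 'cV[rat]_n.
Hypothesis vertex_supported : forall J : {set 'I_n}, J \proper [set: 'I_n] ->
  supported J (vertex J).
Hypothesis vertex_tight : forall J : {set 'I_n}, J \proper [set: 'I_n] ->
  forall j, j \in J -> (A *m vertex J) j 0 = b j 0.
Implicit Types (c v : 'cV[rat]_n) (J : {set 'I_n}).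

Definition polyhedron c :=
  (forall i, 0 <= c i 0) /\ (forall i, (A *m c) i 0 <= b i 0).

(** Nodes at which neither inequality is tight; their number is the induction measure, and a point
    without loose nodes is some [vertex J]. *)
Definition loose c : {set 'I_n} :=
  [set i | (c i 0 != 0) && ((A *m c) i 0 != b i 0)].

Definition decomposed c := exists (p : {set 'I_n} -> rat) (t : rat),
  [/\ forall J, 0 <= p J, \sum_(J : {set 'I_n} | J \proper [set: 'I_n]) p J = 1, 0 <= t &
      c = \sum_(J : {set 'I_n} | J \proper [set: 'I_n]) p J *: vertex J + t *: a].

Lemma decomposed_convex c1 c2 t1 t2 : decomposed c1 -> decomposed c2 ->
  0 <= t1 -> 0 <= t2 -> t1 + t2 = 1 -> decomposed (t1 *: c1 + t2 *: c2).
Proof.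
move=> [p1 [q1 [p10 p1s q10 ->]]] [p2 [q2 [p20 p2s q20 ->]]] t10 t20 t12.
exists (fun J => t1 * p1 J + t2 * p2 J), (t1 * q1 + t2 * q2); split.
- by move=> J; rewrite addr_ge0 ?mulr_ge0.
- by rewrite big_split -!mulr_sumr /= p1s p2s !mulr1.
- by rewrite addr_ge0 ?mulr_ge0.
under [in RHS]eq_bigr do rewrite scalerDl -!scalerA.
by rewrite big_split -!scaler_sumr /= !scalerDr scalerDl !scalerA addrACA.
Qed.

Lemma decomposed_recession c t : decomposed c -> 0 <= t -> decomposed (c + t *: a).
Proof.
move=> [p [q [p0 ps q0 ->]]] t0; exists p, (q + t); split=> //.
  by rewrite addr_ge0.
by rewrite scalerDl addrA.
Qed.

(* Here regularity of the weight is used: [b > 0] prevents the two inequalities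
   indexed by the same node from being tight simultaneously. *)
Lemma polyhedron_slack c i : polyhedron c -> c i 0 = 0 -> (A *m c) i 0 != b i 0.
Proof.
move=> [c0 _] ci; rewrite lt_eqF // (le_lt_trans _ (b_gt0 i)) //.
apply: (supported_mul_le0 aff (J := ~: [set i])) => //; last by rewrite !inE eqxx.
by move=> k; rewrite !inE negbK => /eqP ->.
Qed.

(** Pairing [A v] with the marks gives zero, as a sum of terms of one sign; hence [A v = 0] and [v]
    is isotropic. *)
Lemma recession v : (forall i, 0 <= v i 0) -> (forall i, (A *m v) i 0 <= 0) ->
  exists2 t, 0 <= t & v = t *: a.
Proof.
move=> v0 Av.
have Av0 i : (A *m v) i 0 = 0.
  have ea k : 0 < e k * a k 0.
    by rewrite mulr_gt0 ?(affine_e_gt0 aff) ?(affine_mark_gt0 aff).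
  have : \sum_k - (e k * a k 0 * (A *m v) k 0) = 0.
    by rewrite sumrN; apply/eqP; rewrite oppr_eq0; apply/eqP; exact: (form_marks aff).
  move=> /eqP; rewrite psumr_eq0; last first.
    by move=> k _; rewrite oppr_ge0 pmulr_rle0.
  move/allP/(_ i (mem_index_enum _)) => /=.
  by rewrite oppr_eq0 mulf_eq0 gt_eqF //= => /eqP.
have : form A e v v = 0 by rewrite /form big1 // => i _; rewrite Av0 mulr0.
move/(affine_null aff) => [t vt]; exists t => //.
have i0 := Ordinal n_gt0.
by have := v0 i0; rewrite vt mxE pmulr_lge0 // (affine_mark_gt0 aff).
Qed.

(** Directions along which every inequality tight at [c] remains tight. *)
Definition admissible c v := (forall i, c i 0 = 0 -> v i 0 = 0) /\
  (forall i, (A *m c) i 0 = b i 0 -> (A *m v) i 0 = 0).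

(** Either no inequality ever fails along [v], or one stops at the first that becomes tight. *)
Lemma move_to_facet c v : polyhedron c -> admissible c v ->
  (forall i, 0 <= v i 0) /\ (forall i, (A *m v) i 0 <= 0) \/
  exists t, [/\ 0 < t, polyhedron (c + t *: v) &
                (#|loose (c + t *: v)%R| < #|loose c|)%N].
Proof.
move=> cP [v1 v2]; have [c0 cb] := cP.
pose f (k : 'I_n + 'I_n) :=
  match k with inl i => c i 0 | inr i => b i 0 - (A *m c) i 0 end.
pose h (k : 'I_n + 'I_n) :=
  match k with inl i => v i 0 | inr i => - (A *m v) i 0 end.
case: (pickP (fun k => h k < 0)) => [k hk|hk]; last first.
  left; split=> i; first by have := hk (inl i); rewrite /= ltNge => /negbFE.
  by have := hk (inr i); rewrite /= oppr_lt0 ltNge => /negbFE.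
right; have f0 k' : 0 <= f k' by case: k' => i //=; rewrite subr_ge0.
have fh k' : f k' = 0 -> h k' = 0.
  case: k' => i /=; first exact: v1.
  by move/eqP; rewrite subr_eq0 => /eqP/esym/v2 ->; rewrite oppr0.
have [t [t0 ft [k' fk' ftk']]] := first_hit f0 fh (ex_intro _ k hk).
have cE i : (c + t *: v) i 0 = c i 0 + t * v i 0 by rewrite mxE [X in _ + X]mxE.
have AE i : (A *m (c + t *: v)) i 0 = (A *m c) i 0 + t * (A *m v) i 0.
  by rewrite mulmxDr -scalemxAr mxE [X in _ + X]mxE.
have cvP : polyhedron (c + t *: v).
  split=> i; first by have := ft (inl i); rewrite cE.
  by have := ft (inr i); rewrite AE /=; lra.
exists t; split=> //; apply/proper_card/properP; split.
  apply/fintype.subsetP => i; rewrite !inE cE AE => /andP[ci Ai]; apply/andP; split.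
    by apply: contraNneq ci => c_i; rewrite c_i v1 // mulr0 addr0.
  by apply: contraNneq Ai => A_i; rewrite A_i v2 // mulr0 addr0.
(* The node of the newly tight inequality was loose at [c]: had its other inequality been tight
   there, it would still be, against [polyhedron_slack]. *)
case: k' fk' ftk' => i /= fi fti; exists i; rewrite !inE.
- rewrite fi /=; apply: contraNneq fi => A_i.
  by rewrite -fti; have := polyhedron_slack cvP (etrans (cE i) fti);
     rewrite AE A_i v2 // mulr0 addr0 eqxx.
- by rewrite cE fti eqxx.
- rewrite [X in _ && X](_ : _ = true) ?andbT; last by rewrite eq_sym -subr_eq0.
  apply: contraNneq fi => c_i.
  have tight : (A *m (c + t *: v)) i 0 = b i 0 by rewrite AE; lra.
  have ci' : (c + t *: v) i 0 = 0 by rewrite cE c_i v1 // mulr0 addr0.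
  by have := polyhedron_slack cvP ci'; rewrite tight eqxx.
- by rewrite AE negb_and negbK orbC; apply/orP; left; rewrite negbK; apply/eqP; lra.
Qed.

Lemma admissibleN c v : admissible c v -> admissible c (- v).
Proof.
move=> [v1 v2]; split=> i h; first by rewrite mxE v1 ?oppr0.
by rewrite mulmxN mxE v2 ?oppr0.
Qed.

(** Each node has at most one tight inequality, so the tight ones form a square system in which a
    loose node contributes a zero row; its determinant vanishes. *)
Lemma exists_direction c : polyhedron c -> loose c != finset.set0 ->
  exists2 v, v != 0 & admissible c v.
Proof.
move=> cP /finset.set0Pn[i0]; rewrite inE => /andP[ci0 Ai0].
pose M : 'M[rat]_n := \matrix_(i, j)
  if c i 0 == 0 then (i == j)%:R else if (A *m c) i 0 == b i 0 then A i j else 0.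
have ME (x : 'cV_n) i : (M *m x) i 0 = if c i 0 == 0 then x i 0
    else if (A *m c) i 0 == b i 0 then (A *m x) i 0 else 0.
  rewrite mxE; case: ifP => ci.
    rewrite (bigD1 i) //= !mxE ci eqxx mul1r big1 ?addr0 // => j ji.
    by rewrite mxE ci eq_sym (negPf ji) mul0r.
  case: ifP => Ai.
    by rewrite [RHS]mxE; apply: eq_bigr => j _; rewrite mxE ci Ai.
  by rewrite big1 // => j _; rewrite mxE ci Ai mul0r.
have : \det M^T == 0.
  rewrite det_tr (expand_det_row _ i0) big1 // => j _.
  by rewrite mxE (negPf ci0) (negPf Ai0) mul0r.
case/det0P => v v0 vM; exists v^T; first by apply: contraNneq v0 => v0;
  rewrite -(trmxK v) v0 trmx0.
have {}vM : M *m v^T = 0 by apply: trmx_inj; rewrite trmx_mul trmxK trmx0.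
split=> i h; have := ME v^T i; rewrite vM.
  by rewrite h eqxx [LHS]mxE => <-.
case: eqP => [ci|_]; first by have := polyhedron_slack cP ci; rewrite h eqxx.
by rewrite h eqxx [LHS]mxE => <-.
Qed.

Lemma vertex_decomposed J : J \proper [set: 'I_n] -> decomposed (vertex J).
Proof.
move=> Jp; exists (fun J' => (J' == J)%:R), 0; split=> //.
- by rewrite (bigD1 J) //= eqxx big1 ?addr0 // => J' /andP[_ /negPf ->].
rewrite (bigD1 J) //= eqxx scale1r scale0r addr0 big1 ?addr0 //.
by move=> J' /andP[_ /negPf ->]; rewrite scale0r.
Qed.

(** Induction on the number of loose nodes: [c] either lies between two points with fewer of them,
    or differs from one such point by a nonnegative multiple of the marks. *)
Lemma polyhedron_decomposed c : polyhedron c -> decomposed c.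
Proof.
have [m] := ubnP #|loose c|; elim: m c => // m IH c lt_cm cP.
have [l0|/(exists_direction cP)[v v0 vc]] := eqVneq (loose c) finset.set0.
  pose J := [set i | (A *m c) i 0 == b i 0].
  have cJ : supported J c.
    move=> i; rewrite inE => Ai; apply/eqP; apply: contraT => ci.
    by have : i \in loose c; [rewrite inE ci | rewrite l0 inE].
  (* If all rows were tight, [A c = b] would be positive, yet [A c] pairs to zero with the positive
     marks. *)
  have Jp : J \proper [set: 'I_n].
    rewrite properE finset.subsetT /=; apply/negP => /fintype.subsetP JT.
    have : form A e a c = 0 by exact: (form_marks aff).
    apply/eqP; rewrite gt_eqF // /form.
    have pos i : 0 < e i * a i 0 * (A *m c) i 0.
      have := JT i (finset.in_setT i); rewrite inE => /eqP ->.
      by rewrite !mulr_gt0 ?(affine_e_gt0 aff) ?(affine_mark_gt0 aff).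
    rewrite (bigD1 (Ordinal n_gt0)) //=; apply: ltr_wpDr; last exact: pos.
    by apply: sumr_ge0 => i _; exact: ltW.
  suff -> : c = vertex J by exact: vertex_decomposed.
  apply/eqP; rewrite -subr_eq0; apply/eqP.
  apply: (supported_kernel aff Jp).
    by move=> i iJ; rewrite mxE [X in _ + X]mxE cJ // (vertex_supported Jp) // subr0.
  move=> i iJ; rewrite mulmxBr mxE [X in _ + X]mxE (vertex_tight Jp) //.
  by move: iJ; rewrite inE => /eqP ->; rewrite subrr.
(* A nonzero recession direction is a positive multiple of the marks. Its opposite is not a
   recession direction, so moving backwards stops at a point with fewer loose nodes, and [c] is that
   point plus a multiple of the marks. *)
have back w : w != 0 -> admissible c w ->
    (forall i, 0 <= w i 0) /\ (forall i, (A *m w) i 0 <= 0) -> decomposed c.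
  move=> w0 wc [w1 w2]; have [q q0 wq] := recession w1 w2.
  have [[nw1 _]|[t [t0 tP lt_t]]] := move_to_facet cP (admissibleN wc).
    case/eqP: w0; apply/matrixP => i j; rewrite ord1 [RHS]mxE; apply/eqP.
    by have := nw1 i; rewrite mxE oppr_ge0 eq_le w1 => ->.
  have -> : c = (c + t *: - w) + (t * q) *: a.
    by rewrite -scalerA -wq scalerN subrK.
  apply: decomposed_recession; last by rewrite mulr_ge0 // ltW.
  by apply: IH => //; exact: leq_trans lt_t _.
have [r|[t [t0 tP lt_t]]] := move_to_facet cP vc; first exact: back r.
have [r|[u [u0 uP lt_u]]] := move_to_facet cP (admissibleN vc).
  by apply: back r; [rewrite oppr_eq0 | exact: admissibleN].
have tu : t + u != 0 by rewrite gt_eqF // addr_gt0.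
have -> : c = (u / (t + u)) *: (c + t *: v) + (t / (t + u)) *: (c + u *: - v).
  by apply/matrixP => i j; rewrite !mxE; field.
apply: decomposed_convex.
- by apply: IH => //; exact: leq_trans lt_t _.
- by apply: IH => //; exact: leq_trans lt_u _.
- by rewrite divr_ge0 ?addr_ge0 ?ltW.
- by rewrite divr_ge0 ?addr_ge0 ?ltW.
- by rewrite -mulrDl addrC divff.
Qed.

End Polyhedron.

(** * Finite roots, the highest root and the extended Cartan matrix *)

Lemma root_coroot_pairing l (A : 'M[int]_l) b c :
  generalized_cartan A -> root_coroot A b c -> (c^T *m A *m b) 0 0 = 2.
Proof.
move=> [Adiag _ _]; elim=> [j|i {}b {}c _ IH].
  by rewrite trmx_delta -rowE -colE !mxE.
have mul_unit (m : 'rV[int]_l) : (m *m (delta_mx i 0 : 'cV__)) 0 0 = m 0 i.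
  by rewrite -colE mxE.
have unit_mul (m : 'cV[int]_l) : ((delta_mx i 0 : 'cV__)^T *m m) 0 0 = m i 0.
  by rewrite trmx_delta -rowE mxE.
set p := (A *m b) i 0; set q := (A^T *m c) i 0.
have qE : (c^T *m A) 0 i = q by rewrite /q -(trmxK A) -trmx_mul mxE trmxK.
have -> : (c - q *: delta_mx i 0)^T = c^T - q *: (delta_mx i 0)^T.
  by apply/matrixP => k j; rewrite !mxE.
rewrite !mulmxBl !mulmxBr -!scalemxAr -!scalemxAl.
have := mul_unit (c^T *m A); have := unit_mul (A *m b).
have := unit_mul (A *m delta_mx i 0); rewrite -[in RHS]colE [in RHS]mxE Adiag qE -/p.
rewrite !mulmxA; move: IH; move: (c^T *m A *m b) (c^T *m A *m delta_mx i 0)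
  ((delta_mx i 0)^T *m A *m b) ((delta_mx i 0)^T *m A *m delta_mx i 0).
move=> m1 m2 m3 m4 h1 h4 h3 h2.
by rewrite !mxE h1 h2 h3 h4; ring.
Qed.

(** [E] is half the square length of [b] for the form symmetrized by [e], hence unchanged by
    reflections. *)
Lemma root_coroot_proportional l (A : 'M[int]_l) (e : 'rV[rat]_l) b c :
  (forall i, 0 < e 0 i) ->
  (forall i j, e 0 i * (A i j)%:~R = e 0 j * (A j i)%:~R) ->
  root_coroot A b c ->
  exists2 E : rat, 0 < E & forall i, E * (c i 0)%:~R = e 0 i * (b i 0)%:~R.
Proof.
move=> e0 Asym; elim=> [j|i {}b {}c _ [E E0 IH]].
  exists (e 0 j) => // i; rewrite !mxE eqxx andbT.
  by case: eqP => [->|]; rewrite ?mulr0.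
exists E => // k.
have h : E * ((A^T *m c) i 0)%:~R = e 0 i * ((A *m b) i 0)%:~R.
  rewrite !mxE !rmorph_sum !mulr_sumr; apply: eq_bigr => j _.
  rewrite !mxE !rmorphM /= mulrCA IH mulrA (mulrC _%:~R) -Asym; ring.
rewrite !sub_deltaE !rmorphB !rmorphM /= !mulrBr IH; congr (_ - _).
by case: eqP => [->|]; [rewrite !mulr1 h | rewrite !mulr0].
Qed.

Section Extended.
Variables (l : nat) (A : 'M[int]_l) (th thv : 'cV[int]_l).
Hypothesis simpleA : simple_cartan A.
Hypothesis highest : highest_root A th thv.

Definition extq : 'M[rat]_(1 + l) := map_mx intr (extended_cartan A th thv).
Definition marks : 'cV[rat]_(1 + l) := col_mx 1%:M (map_mx intr th).

Let Aq : 'M[rat]_l := map_mx intr A.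
Let thq : 'cV[rat]_l := map_mx intr th.
Let thvq : 'cV[rat]_l := map_mx intr thv.

Lemma extqE : extq = block_mx 2%:M (- (thvq^T *m Aq)) (- (Aq *m thq)) Aq.
Proof.
rewrite /extq /extended_cartan map_block_mx map_scalar_mx !map_mxN !map_mxM.
by rewrite map_trmx.
Qed.

(** Otherwise reflecting [th] in [alpha_i] would produce a root with a larger i-th coordinate. *)
Lemma highest_dominant i : 0 <= (A *m th) i 0.
Proof.
have [rth /(_ _ _ (RootRefl i rth) i)] := highest.
by rewrite sub_deltaE eqxx mulr1 gerBl.
Qed.

Lemma highest_gt0 i : 0 < th i 0.
Proof.
have [_ /(_ _ _ (RootSimple A i) i)] := highest.
by rewrite mxE !eqxx; exact: lt_le_trans.
Qed.

Lemma symmetrizer_sym (e : 'rV[rat]_l) : let B := diag_mx e *m Aq in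
  B^T = B -> forall i j, e 0 i * (A i j)%:~R = e 0 j * (A j i)%:~R.
Proof.
move=> B Bsym i j; have := congr1 (fun m : 'M_l => m j i) Bsym.
by rewrite mxE /B !mul_diag_mx !mxE.
Qed.

Lemma highest_coroot_gt0 i : 0 < thv i 0.
Proof.
have [_ _ _ [ee [ee0 /symmetrizer_sym Asym _]]] := simpleA.
have [E E0 prop] := root_coroot_proportional ee0 Asym highest.1.
by rewrite -(ltr0z rat) -(pmulr_rgt0 _ E0) prop mulr_gt0 // ltr0z highest_gt0.
Qed.

Lemma extended_affine : exists e, affine_matrix extq e marks.
Proof.
have [_ gcA _ [ee [ee0 Bsym Bpos]]] := simpleA.
have [Adiag Aoff _] := gcA; have [rth _] := highest.
set B := diag_mx ee *m Aq in Bsym Bpos.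
have Asym := symmetrizer_sym Bsym.
have [E E0 prop] := root_coroot_proportional ee0 Asym rth.
have propM : E *: thvq^T = thq^T *m diag_mx ee.
  apply/matrixP => i j; rewrite ord1 mul_mx_diag !mxE prop; ring.
have thB : E *: (thvq^T *m Aq) = thq^T *m B.
  by rewrite scalemxAl propM mulmxA.
have thN : (thq^T *m B *m thq) 0 0 = 2 * E.
  rewrite -thB -scalemxAl mxE mulrC; congr (_ * _).
  rewrite /thvq /Aq /thq map_trmx -!map_mxM mxE.
  by rewrite (root_coroot_pairing gcA rth).
have thA j : 0 <= (Aq *m thq) j 0.
  by rewrite -map_mxM mxE ler0z highest_dominant.
have thvA j : E * (thvq^T *m Aq) 0 j = ee 0 j * (Aq *m thq) j 0.
  have -> : E * (thvq^T *m Aq) 0 j = (E *: (thvq^T *m Aq)) 0 j by rewrite [RHS]mxE.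
  rewrite thB -{1}Bsym -trmx_mul mxE /B -mulmxA mul_diag_mx mxE //.
have oppE m p (M : 'M[rat]_(m, p)) i j : (- M) i j = - M i j by rewrite mxE.
(* [alpha_0 = delta - theta] has the length of [theta], so the symmetrizer is extended by [E] at the
   affine node. *)
pose e (i : 'I_(1 + l)) := match fintype.split i with inl _ => E | inr j => ee 0 j end.
have el (i : 'I_1) : e (lshift l i) = E by rewrite /e (fintype.unsplitK (inl i)).
have er i : e (rshift 1 i) = ee 0 i by rewrite /e (fintype.unsplitK (inr i)).
(* Completing the square: with [x_0] the affine coordinate and [x'] the others, the form is the
   positive definite finite form at [x' - x_0 theta]. It vanishes exactly on multiples of
   [(1, theta)], the marks. *)
have formE x : form extq e x x =
    let y := dsubmx x - x (lshift l 0) 0 *: thq in (y^T *m B *m y) 0 0.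
  pose x0 := x (lshift l 0) 0; pose x' : 'cV_l := dsubmx x.
  have xE : x = col_mx x0%:M x'.
    rewrite -[LHS]vsubmxK; congr col_mx; apply/matrixP => i j.
    by rewrite !ord1 !mxE eqxx mulr1n.
  have XE : extq *m x = col_mx ((2 * x0)%:M - thvq^T *m Aq *m x')
                               (Aq *m (x' - x0 *: thq)).
    rewrite xE extqE mul_block_col -scalar_mxM mulNmx mulNmx mul_mx_scalar.
    by rewrite mulmxBr -scalemxAr [X in col_mx _ X]addrC.
  rewrite /form big_split_ord /= big_ord1 el XE col_mxEu.
  under eq_bigr => i _.
    rewrite er col_mxEd (_ : x (rshift 1 i) 0 = x' i 0); last by rewrite !mxE.
    over.
  have -> : \sum_i ee 0 i * x' i 0 * (Aq *m (x' - x0 *: thq)) i 0 =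
      (x'^T *m B *m (x' - x0 *: thq)) 0 0.
    rewrite /B -!mulmxA mxE; apply: eq_bigr => i _.
    by rewrite mul_diag_mx [X in _ = X * _]mxE [X in _ = _ * X]mxE; ring.
  rewrite -/x' -/x0 -/(x (lshift l 0) 0).
  have -> : ((2 * x0)%:M - thvq^T *m Aq *m x' : 'M_1) 0 0 =
      2 * x0 - (thvq^T *m Aq *m x') 0 0.
    by rewrite mxE [X in _ + X]mxE mxE eqxx mulr1n.
  have h1 : E * (thvq^T *m Aq *m x') 0 0 = (thq^T *m B *m x') 0 0.
    by rewrite -thB -scalemxAl [RHS]mxE.
  have h2 : (x'^T *m B *m thq) 0 0 = (thq^T *m B *m x') 0 0.
    have -> : x'^T *m B *m thq = (thq^T *m B *m x')^T.
      by rewrite trmx_mul (trmx_mul thq^T B) trmxK Bsym mulmxA.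
    by rewrite mxE.
  have -> : (x'^T *m B *m (x' - x0 *: thq)) 0 0 =
      (x'^T *m B *m x') 0 0 - x0 * (x'^T *m B *m thq) 0 0.
    by rewrite mulmxBr -scalemxAr mxE [X in _ + X]mxE [X in - X]mxE.
  have -> : ((x' - x0 *: thq)^T *m B *m (x' - x0 *: thq)) 0 0 =
      (x'^T *m B *m x') 0 0 - x0 * (x'^T *m B *m thq) 0 0 -
      x0 * ((thq^T *m B *m x') 0 0 - x0 * (thq^T *m B *m thq) 0 0).
    have -> : (x' - x0 *: thq)^T = x'^T - x0 *: thq^T.
      by apply/matrixP => k j; rewrite !mxE.
    rewrite !mulmxBl !mulmxBr -!scalemxAr -!scalemxAl.
    move: (x'^T *m B *m x') (x'^T *m B *m thq) (thq^T *m B *m x')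
       (thq^T *m B *m thq) => m1 m2 m3 m4; rewrite !mxE; ring.
  rewrite h2 thN -h1; ring.
exists e; split.
- by move=> i j; rewrite mxE intr_int.
- move=> i; rewrite extqE; case: (split_ordP i) => k ->.
    by rewrite block_mxEul ord1 mxE.
  by rewrite block_mxEdr mxE Adiag.
- move=> i j; rewrite extqE; case: (split_ordP i) => i' ->;
    case: (split_ordP j) => j' ->.
  + by rewrite !ord1 eqxx.
  + rewrite block_mxEur mxE oppr_le0 ord1 -(pmulr_rge0 _ E0) thvA mulr_ge0 //.
    exact: ltW.
  + by rewrite block_mxEdl mxE oppr_le0 ord1.
  + rewrite block_mxEdr mxE lerz0 => ij; apply: Aoff.
    by apply: contraNneq ij => ->.
- by move=> i; case: (split_ordP i) => k ->; rewrite ?el ?er.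
- move=> i j; rewrite extqE; case: (split_ordP i) => i' ->;
    case: (split_ordP j) => j' ->; rewrite ?el ?er.
  + by rewrite !ord1.
  + rewrite block_mxEur block_mxEdl !ord1 !oppE !mulrN; congr (- _).
    exact: thvA.
  + rewrite block_mxEur block_mxEdl !ord1 !oppE !mulrN; congr (- _).
    exact/esym/thvA.
  + by rewrite !block_mxEdr !mxE.
- move=> x; rewrite formE /=; set y := _ - _.
  have [->|y0] := eqVneq y 0; last exact/ltW/Bpos.
  by rewrite mulmx0 mxE.
- move=> x; rewrite formE /=; set y := _ - _ => yB.
  have y0 : y = 0.
    by apply/eqP; apply: contraT => /Bpos; rewrite yB ltxx.
  exists (x (lshift l 0) 0); rewrite scale_col_mx -[LHS]vsubmxK; congr col_mx.
    by apply/matrixP => i j; rewrite !ord1 !mxE eqxx mulr1.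
  by move/eqP: y0; rewrite subr_eq0 => /eqP.
- move=> i; case: (split_ordP i) => k ->; first by rewrite col_mxEu ord1 mxE.
  by rewrite col_mxEd mxE ltr0z highest_gt0.
- rewrite extqE mul_block_col mulmx1 mulmx1 addNr mulNmx -[RHS]col_mx0.
  congr col_mx; apply/matrixP => i j; rewrite !ord1.
  rewrite map_trmx -!map_mxM [RHS]mxE [LHS]mxE oppE [X in X - _]mxE [X in _ - X]mxE.
  by rewrite (root_coroot_pairing gcA rth).
Qed.

End Extended.

Local Open Scope classical_set_scope.

(** * Rational convex hulls *)

Section Convex.
Variables (C : numClosedFieldType) (l : nat) (g : untwisted_affine C l).
Implicit Types (S : set (hdual g)) (mu x y : hdual g).

Lemma convQ_fin S (T : finType) (c : T -> rat) (v : T -> hdual g) :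
  (forall t, 0 <= c t) -> \sum_t c t = 1 -> (forall t, S (v t)) ->
  convQ S (\sum_t ratr (c t) *: v t).
Proof.
move=> c0 c1 Sv; exists #|T|, (c \o enum_val), (v \o enum_val); split=> //=.
- by rewrite -c1 [RHS](reindex (fun i : 'I_#|T| => enum_val i)) //; exact/onW_bij/enum_val_bij.
- by rewrite [LHS](reindex (fun i : 'I_#|T| => enum_val i)) //; exact/onW_bij/enum_val_bij.
Qed.

Lemma sub_convQ S x : S x -> convQ S x.
Proof.
move=> Sx; have := @convQ_fin S unit (fun=> 1) (fun=> x) => h.
have <- : \sum_(t : unit) ratr 1 *: x = x.
  by rewrite sumr_const card_unit rmorph1 scale1r.
by apply: h => //; rewrite sumr_const card_unit.
Qed.

Lemma convQ_idem S x : convQ (convQ S) x -> convQ S x.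
Proof.
move=> [n [c [v [c0 c1 Sv ->]]]].
have ex k : exists p : {m : nat & (('I_m -> rat) * ('I_m -> hdual g))%type},
    [/\ forall j, 0 <= (tagged p).1 j, \sum_j (tagged p).1 j = 1,
        forall j, S ((tagged p).2 j) &
        v k = \sum_j ratr ((tagged p).1 j) *: (tagged p).2 j].
  by have [m [d [w dw]]] := Sv k; exists (existT _ m (d, w)).
have [p pP] := choice ex.
(* The nested combination is flattened over pairs of an outer and an inner index, with the products
   of the coefficients. *)
have -> : \sum_k ratr (c k) *: v k = \sum_(t : {k : 'I_n & 'I_(tag (p k))})
    ratr (c (tag t) * (tagged (p (tag t))).1 (tagged t)) *:
    (tagged (p (tag t))).2 (tagged t).
  rewrite -(@sig_big_dep _ _ _ _ (fun k => 'I_(tag (p k))) predT (fun=> predT)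
    (fun k j => ratr (c k * (tagged (p k)).1 j) *: (tagged (p k)).2 j)) /=.
  apply: eq_bigr => k _; have [_ _ _ ->] := pP k; rewrite scaler_sumr.
  by apply: eq_bigr => j _; rewrite rmorphM scalerA.
apply: convQ_fin => [t||t].
- by rewrite mulr_ge0 //; have [d0 _ _ _] := pP (tag t).
- rewrite -(@sig_big_dep _ _ _ _ (fun k => 'I_(tag (p k))) predT (fun=> predT)
    (fun k j => c k * (tagged (p k)).1 j)) /= -[RHS]c1.
  by apply: eq_bigr => k _; have [_ d1 _ _] := pP k; rewrite -mulr_sumr d1 mulr1.
- by have [_ _ Sw _] := pP (tag t).
Qed.

Lemma convQ_linear S S' (u : 'End(hdual g)) x :
  (forall y, S y -> S' (u y)) -> convQ S x -> convQ S' (u x).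
Proof.
move=> uS [n [c [v [c0 c1 Sv ->]]]].
exists n, c, (fun k => u (v k)); split=> //; first by move=> k; exact: uS.
by rewrite linear_sum; apply: eq_bigr => k _; rewrite linearZ.
Qed.

Lemma convQ_segment S x y t : convQ S x -> convQ S y -> 0 <= t <= 1 ->
  convQ S (ratr (1 - t) *: x + ratr t *: y).
Proof.
move=> Sx Sy /andP[t0 t1]; apply: convQ_idem.
have := @convQ_fin (convQ S) bool (fun b => if b then 1 - t else t)
  (fun b => if b then x else y).
by rewrite !big_bool /=; apply=> [[]||[]] //; rewrite ?subr_ge0 ?subrK.
Qed.

End Convex.

(** * The Weyl group on weights and the finiteness of [W_J] *)

Section Weyl.
Variables (C : numClosedFieldType) (l : nat) (g : untwisted_affine C l).
Implicit Types (mu nu lam : hdual g) (J : {set 'I_(1 + l)}) (s : seq 'I_(1 + l)).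

Let X := extq (fin_cartan g) (theta g) (thetav g).
Let a := marks (theta g).

Definition comb (c : 'cV[rat]_(1 + l)) : hdual g :=
  \sum_i ratr (c i 0) *: alpha g i.

Lemma combD c d : comb (c + d) = comb c + comb d.
Proof.
rewrite /comb -big_split; apply: eq_bigr => i _.
by rewrite mxE rmorphD scalerDl.
Qed.

Lemma combZ t c : comb (t *: c) = ratr t *: comb c.
Proof.
rewrite /comb scaler_sumr; apply: eq_bigr => i _.
by rewrite mxE rmorphM scalerA.
Qed.

Lemma comb0 : comb 0 = 0.
Proof. by rewrite -(scale0r 0) combZ rmorph0 scale0r. Qed.

Lemma combN c : comb (- c) = - comb c.
Proof. by rewrite -scaleN1r combZ rmorphN1 scaleN1r. Qed.

Lemma comb_sum (T : finType) (c : T -> rat) (y : T -> 'cV[rat]_(1 + l)) :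
  comb (\sum_t c t *: y t) = \sum_t ratr (c t) *: comb (y t).
Proof.
rewrite (big_morph comb combD comb0); apply: eq_bigr => t _.
exact: combZ.
Qed.

Lemma comb_delta i : comb (delta_mx i 0) = alpha g i.
Proof.
rewrite /comb (bigD1 i) //= mxE !eqxx rmorph1 scale1r big1 ?addr0 // => j ji.
by rewrite mxE (negPf ji) rmorph0 scale0r.
Qed.

Lemma lshift_ord0 : lshift l 0 = ord0 :> 'I_(1 + l).
Proof. exact: val_inj. Qed.

Lemma comb_marks : comb a = delta g.
Proof.
rewrite /comb big_split_ord /= big_ord1 col_mxEu mxE eqxx mulr1n rmorph1 scale1r.
rewrite lshift_ord0 /delta; congr (_ + _); apply: eq_bigr => i _.
by rewrite col_mxEd mxE ratr_int.
Qed.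

Lemma comb_coroot c i : comb c (alphav g i) = ratr ((X *m c) i 0) :> C.
Proof.
rewrite /comb sum_lfunE mxE rmorph_sum; apply: eq_bigr => j _.
have -> : X i j = (extended_cartan (fin_cartan g) (theta g) (thetav g) i j)%:~R.
  by rewrite /X /extq [LHS]mxE.
by rewrite scale_lfunE alphaE rmorphM /= ratr_int -[LHS]/(_ * _) mulrC.
Qed.

Lemma comb_der c : comb c (der g) = ratr (c ord0 0) :> C.
Proof.
rewrite /comb sum_lfunE (bigD1 ord0) //= scale_lfunE alpha_d eqxx.
rewrite big1 ?addr0 => [|i /negPf i0]; first exact: mulr1.
by rewrite scale_lfunE alpha_d i0 -[LHS]/(_ * _) mulr0.
Qed.

Lemma extq_marks : X *m a = 0.
Proof.
by have [e /affine_mark0] := extended_affine (fin_cartanP g) (thetaP g).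
Qed.

Lemma delta_coroot i : delta g (alphav g i) = 0 :> C.
Proof. by rewrite -comb_marks comb_coroot extq_marks mxE rmorph0. Qed.

Lemma delta_der : delta g (der g) = 1 :> C.
Proof.
rewrite -comb_marks comb_der -lshift_ord0 col_mxEu mxE eqxx mulr1n.
exact: rmorph1.
Qed.

(** The simple coroots and [der] form a basis: [delta] kills the coroots but not [der], and there
    are [l + 2] vectors. *)
Lemma hdual_ext mu nu : (forall i, mu (alphav g i) = nu (alphav g i)) ->
  mu (der g) = nu (der g) -> mu = nu.
Proof.
move=> eq_av eq_d.
pose B := der g :: [seq alphav g i | i <- enum 'I_(1 + l)].
have B_free : free B.
  rewrite free_cons alphav_free andbT; apply/negP => d_span.
  have /span_lfunP/(_ _ d_span) : {in [seq alphav g i | i <- enum 'I_(1 + l)],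
      (delta g : 'Hom(_, _)) =1 (0 : 'Hom(hspace g, C^o))}.
    by move=> _ /mapP[i _ ->]; rewrite zero_lfunE; exact: delta_coroot.
  by rewrite zero_lfunE delta_der => /eqP; rewrite oner_eq0.
have B_full : <<B>>%VS = fullv.
  apply/eqP; rewrite eqEdim subvf dim_h; move: B_free; rewrite /free => /eqP ->.
  by rewrite /= size_map size_enum_ord.
apply/lfunP => h; have : h \in <<B>>%VS by rewrite B_full memvf.
have /span_lfunP : {in B, mu =1 nu}; last exact.
by move=> x; rewrite inE => /orP[/eqP ->|/mapP[i _ ->]].
Qed.

Lemma srefl_comb i c : srefl g i (comb c) = comb (refl X i c).
Proof. by rewrite sreflE comb_coroot combD combN combZ comb_delta. Qed.

Lemma srefl_weight lam (b : 'cV[rat]_(1 + l)) i y :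
  (forall i, lam (alphav g i) = ratr (b i 0) :> C) ->
  srefl g i (lam - comb y) = lam - comb (arefl X b i y).
Proof.
move=> lamE; rewrite sreflE combD combZ comb_delta add_lfunE opp_lfunE lamE.
by rewrite [(comb y) _]comb_coroot rmorphB opprD addrA.
Qed.

Lemma alpha_alphav i : alpha g i (alphav g i) = 2 :> C.
Proof.
have [e /affine_diag diag2] := extended_affine (fin_cartanP g) (thetaP g).
by rewrite -comb_delta comb_coroot mulmx_unit diag2 rmorph_nat.
Qed.

Lemma srefl_invol i mu : srefl g i (srefl g i mu) = mu.
Proof.
rewrite sreflE [srefl g i mu]sreflE add_lfunE opp_lfunE scale_lfunE alpha_alphav.
set m : C := mu _.
have -> : m - m *: (2 : C^o) = - m by rewrite -[_ *: _]/(m * 2); ring.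
by rewrite scaleNr opprK subrK.
Qed.

Definition wword s : 'End(hdual g) :=
  foldr (fun i u => (srefl g i \o u)%VF) \1%VF s.

Lemma wword_cons i s mu : wword (i :: s) mu = srefl g i (wword s mu).
Proof. by rewrite /= comp_lfunE. Qed.

Lemma wword_cat s t mu : wword (s ++ t) mu = wword s (wword t mu).
Proof.
elim: s => [|i s IH]; first by rewrite /= id_lfunE.
by rewrite cat_cons !wword_cons IH.
Qed.

Lemma wword_rev s mu : wword (rev s) (wword s mu) = mu.
Proof.
elim: s mu => [|i s IH] mu; first by rewrite /= !id_lfunE.
rewrite rev_cons -cats1 wword_cat !wword_cons.
by rewrite [wword [::] _]id_lfunE srefl_invol IH.
Qed.

Lemma wword_inv s : ((wword s)^-1)%VF = wword (rev s).
Proof.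
have ker0 : lker (wword s) == 0%VS.
  apply/lker0P => mu nu eq_s.
  by rewrite -(wword_rev s mu) eq_s wword_rev.
apply/lfunP => mu.
have -> : mu = wword s (wword (rev s) mu).
  by rewrite -{1}(revK s) wword_rev.
by rewrite wword_rev lker0_lfunK.
Qed.

(** Simple reflections are involutions, so the inverse of a word is the reversed word. *)
Lemma weylP J u : weyl J u <-> exists2 s, all (mem J) s & u = wword s.
Proof.
split; last first.
  case=> s + ->; elim: s => [|i s IH] /=; first by move=> _; exact: weyl_id.
  by case/andP => iJ /IH; apply: weyl_comp; exact: weyl_refl.
elim=> [j jJ||{}u v _ [s sJ ->] _ [t tJ ->]|{}u _ [s sJ ->]].
- exists [:: j]; first by rewrite /= andbT.
  by apply/lfunP => mu; rewrite comp_lfunE id_lfunE.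
- by exists [::].
- exists (s ++ t); first by rewrite all_cat sJ.
  by apply/lfunP => mu; rewrite wword_cat comp_lfunE.
- by exists (rev s); rewrite ?all_rev ?wword_inv.
Qed.

Lemma wword_comb s c : wword s (comb c) = comb (rword X s c).
Proof.
elim: s => [|i s IH]; first by rewrite id_lfunE.
by rewrite wword_cons IH srefl_comb.
Qed.

Lemma wword_weight lam (b : 'cV[rat]_(1 + l)) s y :
  (forall i, lam (alphav g i) = ratr (b i 0) :> C) ->
  wword s (lam - comb y) = lam - comb (aword X b s y).
Proof.
move=> lamE; elim: s => [|i s IH]; first by rewrite id_lfunE.
by rewrite wword_cons IH (srefl_weight _ _ lamE).
Qed.

Lemma srefl_fixed i mu : mu (alphav g i) = 0 :> C -> srefl g i mu = mu.
Proof. by move=> mu0; rewrite sreflE mu0 scale0r subr0. Qed.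

Lemma wword_fixed J s mu : all (mem J) s ->
  (forall j, j \in J -> mu (alphav g j) = 0 :> C) -> wword s mu = mu.
Proof.
move=> + muJ; elim: s => [|i s IH] /=; first by rewrite id_lfunE.
by case/andP => iJ /IH; rewrite comp_lfunE => ->; apply/srefl_fixed/muJ.
Qed.

Lemma wword_delta s : wword s (delta g) = delta g.
Proof.
apply: (@wword_fixed [set: 'I_(1 + l)]%SET); last by move=> j _; exact: delta_coroot.
by apply/allP => i _; rewrite /= inE.
Qed.

(* A weight splits into a combination of the [alpha_j], [j \in J], and a part
   fixed by [weyl J], because the principal submatrix on [J] is invertible. *)
Lemma wword_eq J s t : J \proper [set: 'I_(1 + l)]%SET ->
  all (mem J) s -> all (mem J) t ->
  (forall j, j \in J -> wword s (alpha g j) = wword t (alpha g j)) ->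
  wword s = wword t.
Proof.
move=> Jp sJ tJ st.
have [e aff] := extended_affine (fin_cartanP g) (thetaP g).
have ex k : exists x : 'cV[rat]_(1 + l),
    supported J x /\ forall j, j \in J -> (X *m x) j 0 = (j == k)%:R.
  have [x sx xE] := supported_solution aff (delta_mx k 0) Jp.
  by exists x; split=> // j /xE ->; rewrite mxE eqxx andbT.
have [w wP] := choice ex.
apply/lfunP => mu.
pose rt := \sum_(k in J) (mu (alphav g k) : C) *: comb (w k).
have rtE : wword s rt = wword t rt.
  rewrite !linear_sum; apply: eq_bigr => k kJ; rewrite !linearZ; congr (_ *: _).
  rewrite /comb !linear_sum; apply: eq_bigr => j _; rewrite !linearZ /=.
  case: (boolP (j \in J)) => jJ; first by rewrite st.
  by rewrite (wP k).1 // rmorph0 !scale0r.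
have fixE j : j \in J -> (mu - rt) (alphav g j) = 0 :> C.
  move=> jJ; rewrite add_lfunE opp_lfunE sum_lfunE (bigD1 j) //= scale_lfunE comb_coroot.
  rewrite (wP j).2 // eqxx rmorph1 big1 => [|k /andP[kJ kj]].
    by rewrite -[_ *: (1 : C^o)]/(_ * _) mulr1 addr0 subrr.
  rewrite scale_lfunE comb_coroot (wP k).2 // eq_sym (negPf kj) rmorph0.
  by rewrite -[LHS]/(_ * _) mulr0.
rewrite -[mu](subrK rt) [LHS]linearD [RHS]linearD /= rtE; congr (_ + _).
by rewrite (wword_fixed sJ fixE) (wword_fixed tJ fixE).
Qed.

(** An element of [W_J] is determined by the images of the [alpha_j], [j \in J], whose integer
    coordinates are bounded by [supported_coord_bound]. *)
Lemma finite_weyl J : J \proper [set: 'I_(1 + l)]%SET -> finite_set (weyl (g := g) J).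
Proof.
move=> Jp; have [e aff] := extended_affine (fin_cartanP g) (thetaP g).
have [N NP] := supported_coord_bound aff Jp.
(* Ordinals are shifted to the integers from [-N] to [N], so that a finite function [f] tabulates
   the coordinates of the images of the simple roots. *)
pose val_of (k : 'I_(N + N).+1) : rat := k%:R - N%:R.
pose T := {ffun 'I_(1 + l) * 'I_(1 + l) -> 'I_(N + N).+1}.
pose col_of (f : T) j : 'cV[rat]_(1 + l) := \col_k val_of (f (j, k)).
pose fib (f : T) := [set u | weyl J u /\
  forall j, j \in J -> u (alpha g j) = comb (col_of f j)].
have : finite_set (\bigcup_(f in [set: T]) fib f).
  apply: bigcup_finite => [|f _]; first exact: finite_finset.
  (* By [wword_eq], each table comes from at most one element. *)
  have [[u0 fu0]|nofib] := pselect (exists u, fib f u); last first.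
    by rewrite (_ : fib f = set0) //; apply/seteqP; split=> // u fu;
      case: nofib; exists u.
  apply: (@sub_finite_set _ _ [set u0]) => // u [].
  case/weylP => s sJ -> sE; case: fu0 => /weylP[t tJ ->] tE.
  by apply: (wword_eq Jp sJ tJ) => j jJ; rewrite sE ?tE.
apply: sub_finite_set => u uJ; have [s sJ us] := (weylP J u).1 uJ.
have coordP (jk : 'I_(1 + l) * 'I_(1 + l)) : exists v : 'I_(N + N).+1,
    jk.1 \in J -> val_of v = rword X s (delta_mx jk.1 0) jk.2 0.
  case: jk => j k /=; case: (boolP (j \in J)) => jJ; last by exists 0.
  have rsupp : supported J (rword X s (delta_mx j 0)).
    apply: (rword_supported X sJ) => i iJ; rewrite mxE eqxx andbT.
    by case: eqP iJ => [->|]; rewrite ?jJ.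
  have [/intrP[z zE] _] := integral_root_rword aff j s k.
  have := NP j _ k rsupp; rewrite (form_rword aff) form_unit mulmx_unit.
  rewrite (affine_diag aff) mulrC => /(_ erefl).
  rewrite zE -intr_norm -[N%:R]/(N%:~R) ler_int => zN.
  have zlt : (`|(z + N%:Z)%R|%N < (N + N).+1)%N by lia.
  exists (Ordinal zlt) => _; rewrite /val_of /= -[X in X - _]/(`|_|%N%:~R).
  have -> : (`|(z + N%:Z)%R|%N : int) = z + N%:Z by lia.
  by rewrite rmorphD /= addrK.
have [f fP] := choice coordP.
exists [ffun jk => f jk] => //; split=> // j jJ.
rewrite us -comb_delta wword_comb; congr comb; apply/matrixP => k k'.
by rewrite ord1 mxE ffunE (fP (j, k)).
Qed.

End Weyl.

(** * The reflection in the highest root and translations *)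

Section HighestReflection.
Variables (C : numClosedFieldType) (l : nat) (g : untwisted_affine C l).
Implicit Types (mu : hdual g) (b c : 'cV[int]_l).

Definition root_weight b : hdual g :=
  \sum_i (b i 0)%:~R *: alpha g (rshift 1 i).

Definition coroot_eval c mu : C :=
  \sum_i (c i 0)%:~R * mu (alphav g (rshift 1 i)).

Lemma alpha_fin i j : alpha g (rshift 1 j) (alphav g (rshift 1 i)) =
  (fin_cartan g i j)%:~R.
Proof. by rewrite alphaE block_mxEdr. Qed.

Lemma root_weight_coroot b i :
  root_weight b (alphav g (rshift 1 i)) = ((fin_cartan g *m b) i 0)%:~R :> C.
Proof.
rewrite sum_lfunE mxE rmorph_sum; apply: eq_bigr => j _.
by rewrite scale_lfunE alpha_fin rmorphM -[LHS]/(_ * _) mulrC.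
Qed.

Lemma coroot_eval_root c b :
  coroot_eval c (root_weight b) = ((c^T *m fin_cartan g *m b) 0 0)%:~R.
Proof.
rewrite -mulmxA mxE rmorph_sum; apply: eq_bigr => i _.
by rewrite root_weight_coroot [in RHS]mxE rmorphM.
Qed.

Lemma coroot_evalB c mu (t : C) nu :
  coroot_eval c (mu - t *: nu) = coroot_eval c mu - t * coroot_eval c nu.
Proof.
rewrite /coroot_eval mulr_sumr -sumrB; apply: eq_bigr => i _.
rewrite add_lfunE opp_lfunE scale_lfunE -[_ *: (nu _ : C^o)]/(_ * _).
by rewrite mulrBr mulrCA.
Qed.

Lemma root_weightB b (t : int) i :
  root_weight (b - t *: delta_mx i 0) = root_weight b - t%:~R *: alpha g (rshift 1 i).
Proof.
have -> : alpha g (rshift 1 i) = \sum_j (j == i)%:R *: alpha g (rshift 1 j).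
  rewrite (bigD1 i) //= eqxx scale1r big1 ?addr0 // => j /negPf ->.
  by rewrite scale0r.
rewrite scaler_sumr -sumrB; apply: eq_bigr => j _.
by rewrite sub_deltaE rmorphB rmorphM rmorph_nat scalerBl scalerA.
Qed.

Lemma coroot_eval_srefl c i mu :
  coroot_eval c (srefl g (rshift 1 i) mu) =
  coroot_eval (c - ((fin_cartan g)^T *m c) i 0 *: delta_mx i 0) mu.
Proof.
rewrite sreflE coroot_evalB /coroot_eval.
under [RHS]eq_bigr do rewrite sub_deltaE rmorphB rmorphM rmorph_nat mulrBl.
rewrite sumrB; congr (_ - _).
rewrite [RHS](bigD1 i) //= eqxx mulr1 [X in _ = _ + X]big1 => [|j ji]; last first.
  by rewrite (negPf ji) mulr0 mul0r.
rewrite addr0 mulrC; congr (_ * _); rewrite mxE rmorph_sum; apply: eq_bigr => j _.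
by rewrite mxE rmorphM alpha_fin mulrC.
Qed.

(** The reflection in [s_i b] is the reflection in [b] conjugated by [s_i]. *)
Lemma root_reflection b c : root_coroot (fin_cartan g) b c ->
  exists s, forall mu, wword g s mu = mu - coroot_eval c mu *: root_weight b.
Proof.
elim=> [j|i {}b {}c _ [s sE]].
  exists [:: rshift 1 j] => mu; rewrite wword_cons id_lfunE sreflE.
  congr (_ - _ *: _).
    rewrite /coroot_eval (bigD1 j) //= mxE !eqxx mul1r big1 ?addr0 // => i ij.
    by rewrite mxE (negPf ij) mul0r.
  rewrite /root_weight (bigD1 j) //= mxE !eqxx scale1r big1 ?addr0 // => i ij.
  by rewrite mxE (negPf ij) scale0r.
exists (rshift 1 i :: s ++ [:: rshift 1 i]) => mu.
rewrite wword_cons wword_cat wword_cons [wword g [::] _]id_lfunE sE.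
rewrite linearB linearZ /= srefl_invol -coroot_eval_srefl; congr (_ - _ *: _).
by rewrite sreflE root_weight_coroot root_weightB.
Qed.

(** The value of [mu] on the central element [K = alpha_0^vee + theta^vee]. *)
Definition level mu : C := mu (alphav g ord0) + coroot_eval (thetav g) mu.

Lemma delta_root : delta g = alpha g ord0 + root_weight (theta g).
Proof. by []. Qed.

(* The two points are the images under the translations by [+theta] and
   [-theta], namely [mu +- k theta - (k +- m) delta] with [k] the level of [mu]
   and [m] its value on the highest coroot. *)
Lemma translation_pair mu : exists s t,
  wword g s mu + wword g t mu = 2 *: (mu - level mu *: delta g).
Proof.
have [s sE] := root_reflection (thetaP g).1.
(* The two products of [s_0] with the reflection in [theta] are mutually inverse translations. *)
exists (ord0 :: s), (s ++ [:: ord0]).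
rewrite wword_cat !wword_cons [wword g [::] _]id_lfunE !sE.
set th := root_weight _; set m := coroot_eval _ mu.
have a0E : alpha g ord0 = delta g - th by rewrite delta_root addrK.
have thth : coroot_eval (thetav g) th = 2.
  rewrite coroot_eval_root (root_coroot_pairing _ (thetaP g).1) //.
  by have [] := fin_cartanP g.
have thd : coroot_eval (thetav g) (delta g) = 0.
  by rewrite /coroot_eval big1 // => i _; rewrite delta_coroot mulr0.
have tha0 : th (alphav g ord0) = - 2 :> C.
  have := delta_coroot g ord0; rewrite delta_root add_lfunE alpha_alphav -/th.
  by move/eqP; rewrite addrC addr_eq0 => /eqP.
pose k := level mu; have ka0 : mu (alphav g ord0) = k - m by rewrite /k /level addrK.
rewrite !sreflE add_lfunE opp_lfunE scale_lfunE -[_ *: (th _ : C^o)]/(_ * _) tha0.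
rewrite ka0 a0E coroot_evalB -/m.
have -> : coroot_eval (thetav g) (delta g - th) = - 2.
  by have := coroot_evalB (thetav g) (delta g) 1 th; rewrite scale1r thd thth => ->; ring.
rewrite -/k; apply/lfunP => h.
have scaleE (p : C) (q : C^o) : p *: q = p * q :> C by [].
rewrite !(add_lfunE, opp_lfunE, scale_lfunE) !scaleE.
move: (mu h : C) (th h : C) (delta g h : C) => x y z; ring.
Qed.

End HighestReflection.

(** * The dominant polyhedron of a regular dominant weight *)

Section DominantPolyhedron.
Variables (C : numClosedFieldType) (l : nat) (g : untwisted_affine C l).
Variables (lam : hdual g) (b : 'cV[rat]_(1 + l)).
Hypothesis lamE : forall i, lam (alphav g i) = ratr (b i 0) :> C.
Hypothesis b_gt0 : forall i, 0 < b i 0.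

Let X := extq (fin_cartan g) (theta g) (thetav g).
Let a := marks (theta g).
Implicit Types (mu x : hdual g) (y : 'cV[rat]_(1 + l)) (J : {set 'I_(1 + l)}).

Definition weight y : hdual g := lam - comb g y.

Definition orbit J : set (hdual g) := [set (w : 'End(hdual g)) lam | w in weyl J].

Lemma orbit_wword J s : all (mem J) s -> orbit J (wword g s lam).
Proof. by move=> sJ; exists (wword g s) => //; apply/weylP; exists s. Qed.

Lemma allT s : all (mem [set: 'I_(1 + l)]%SET) s.
Proof. by apply/allP => i _; rewrite /= inE. Qed.

Lemma wword_lam s : wword g s lam = weight (aword X b s 0).
Proof. by rewrite -[in LHS](subr0 lam) -(comb0 g) (wword_weight _ _ lamE). Qed.

Lemma weight_coroot y i : weight y (alphav g i) = ratr (b i 0 - (X *m y) i 0) :> C.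
Proof. by rewrite add_lfunE opp_lfunE lamE [comb g y _]comb_coroot rmorphB. Qed.

Lemma weight_sum (T : finType) (c : T -> rat) (y : T -> 'cV[rat]_(1 + l)) :
  \sum_t c t = 1 ->
  weight (\sum_t c t *: y t) = \sum_t ratr (c t) *: weight (y t).
Proof.
move=> c1; rewrite /weight comb_sum.
under [RHS]eq_bigr do rewrite scalerBr.
by rewrite sumrB -scaler_suml -rmorph_sum c1 rmorph1 scale1r.
Qed.

Lemma weight_marks y t : weight (y + t *: a) = weight y + ratr t *: - delta g.
Proof. by rewrite /weight combD combZ comb_marks opprD addrA scalerN. Qed.

Lemma convQ_weight (S : set (hdual g)) (P : 'cV[rat]_(1 + l) -> Prop) mu :
  (forall x, S x -> exists2 y, P y & x = weight y) -> convQ S mu ->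
  exists n (c : 'I_n -> rat) (y : 'I_n -> 'cV[rat]_(1 + l)),
    [/\ forall k, 0 <= c k, \sum_k c k = 1, forall k, P (y k) &
        mu = weight (\sum_k c k *: y k)].
Proof.
move=> SP [n [c [v [c0 c1 Sv ->]]]].
have ex k : exists y, P y /\ v k = weight y.
  by have [y Py vy] := SP _ (Sv k); exists y.
have [y yP] := choice ex.
exists n, c, y; split=> // [k|]; first by have [] := yP k.
by rewrite weight_sum //; apply: eq_bigr => k _; have [_ ->] := yP k.
Qed.

Lemma bhat_convQ J : J \proper [set: 'I_(1 + l)]%SET ->
  convQ (orbit J) (bhat J lam).
Proof.
move=> Jp; have finJ := finite_weyl g Jp.
rewrite /bhat; set F := fset_set _; set N := #|` F|%fset.
have N0 : (N%:R : rat) != 0.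
  rewrite pnatr_eq0 -lt0n cardfs_gt0; apply/fset0Pn; exists \1%VF.
  by rewrite in_fset_set // inE; exact: weyl_id.
have := @convQ_fin _ _ g (orbit J) 'I_N (fun=> N%:R^-1)
  (fun k => nth \1%VF F k lam).
rewrite -scaler_sumr fmorphV rmorph_nat.
rewrite (big_nth \1%VF) big_mkord; apply.
- by move=> _; rewrite invr_ge0 ler0n.
- by rewrite sumr_const card_ord -[RHS](mulVf N0) mulr_natr.
- move=> k; exists (nth \1%VF F k) => //.
  have : nth \1%VF F k \in F by apply: mem_nth; exact: ltn_ord.
  by rewrite in_fset_set // inE.
Qed.

(** Left multiplication by [s_j] permutes [W_J]. *)
Lemma bhat_srefl J j : J \proper [set: 'I_(1 + l)]%SET -> j \in J ->
  srefl g j (bhat J lam) = bhat J lam.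
Proof.
move=> Jp jJ; have finJ := finite_weyl g Jp.
rewrite /bhat linearZ linear_sum /=; congr (_ *: _); set F := fset_set _.
have inF u : (u \in F) = (u \in weyl J) by rewrite in_fset_set.
pose f (u : 'End(hdual g)) := (srefl g j \o u)%VF.
have fK : involutive f.
  by move=> u; apply/lfunP => mu; rewrite !comp_lfunE srefl_invol.
have fF u : u \in F -> f u \in F.
  by rewrite !inF !inE => uJ; apply: weyl_comp => //; exact: weyl_refl.
have permF : perm_eq [seq f u | u <- F] F.
  apply: uniq_perm.
  - by rewrite map_inj_uniq ?fset_uniq //; exact: inv_inj.
  - exact: fset_uniq.
  move=> u; apply/mapP/idP => [[v vF ->]|uF]; first exact: fF.
  by exists (f u); rewrite ?fK ?fF.
rewrite -[RHS](perm_big _ permF) big_map; apply: eq_bigr => u _.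
by rewrite /f comp_lfunE.
Qed.

(** The support comes from averaging points of the [W_J]-orbit; tightness at [j] says that
    [bhat J lam] vanishes on the coroot of [j], which follows from its invariance under [s_j]. *)
Lemma bhat_weight J : J \proper [set: 'I_(1 + l)]%SET ->
  exists y, [/\ bhat J lam = weight y, supported J y &
    forall j, j \in J -> (X *m y) j 0 = b j 0].
Proof.
move=> Jp.
have orbP x : orbit J x -> exists2 y, supported J y & x = weight y.
  case=> _ /weylP[s sJ ->] <-; rewrite wword_lam; exists (aword X b s 0) => //.
  elim: s sJ => [|i s IH] /=; first by move=> _ i iJ; rewrite mxE.
  case/andP => iJ /IH ys k kJ; rewrite mxE ys // add0r !mxE.
  by case: eqP kJ => [->|]; rewrite ?[i \in J]iJ // mulr0.
have [n [c [y [c0 c1 yJ bE]]]] := convQ_weight orbP (bhat_convQ Jp).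
exists (\sum_k c k *: y k); split=> // [i iJ|j jJ].
  by rewrite summxE big1 // => k _; rewrite mxE yJ // mulr0.
have := bhat_srefl Jp jJ; rewrite bE sreflE -[X in _ = X]subr0.
move=> /addrI/oppr_inj/eqP; rewrite scaler_eq0 weight_coroot => /orP[|/eqP aj0].
  by rewrite fmorph_eq0 subr_eq0 => /eqP.
have := alpha_alphav g j; rewrite aj0 zero_lfunE => /eqP.
by rewrite eq_sym pnatr_eq0.
Qed.

Lemma level_lam : exists2 k : rat, 0 < k & level lam = ratr k.
Proof.
exists (b ord0 0 + \sum_i (thetav g i 0)%:~R * b (rshift 1 i) 0).
  apply: ltr_wpDr => //; apply: sumr_ge0 => i _; rewrite mulr_ge0 ?(ltW (b_gt0 _)) //.
  by rewrite ler0z ltW // (highest_coroot_gt0 (fin_cartanP g) (thetaP g)).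
rewrite /level lamE rmorphD /= rmorph_sum; congr (_ + _); apply: eq_bigr => i _.
by rewrite lamE rmorphM /= ratr_int.
Qed.

Let OW := orbit [set: 'I_(1 + l)]%SET.

(** The midpoint of the two translates of [lam] is [lam - k delta] with [k] its positive level. As
    [W] fixes [delta], the hull is stable under subtracting [k delta], hence multiples of it, and by
    convexity anything in between. *)
Lemma orbit_recession mu q : convQ OW mu -> 0 <= q ->
  convQ OW (mu + ratr q *: - delta g).
Proof.
have [k k0 kE] := level_lam.
have base : convQ OW (lam + ratr k *: - delta g).
  have [s [t stE]] := translation_pair lam.
  have := @convQ_segment _ _ _ OW (wword g s lam) (wword g t lam) 2^-1.
  have -> : 1 - 2^-1 = 2^-1 :> rat by [].
  rewrite -scalerDr stE kE fmorphV rmorph_nat scalerA mulVf ?pnatr_eq0 // scale1r.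
  rewrite scalerN; apply=> //; exact/sub_convQ/orbit_wword/allT.
have step x : convQ OW x -> convQ OW (x + ratr k *: - delta g).
  move=> [n [c [v [c0 c1 Sv ->]]]]; apply: convQ_idem.
  exists n, c, (fun j => v j + ratr k *: - delta g); split=> //; last first.
    under [RHS]eq_bigr do rewrite scalerDr.
    by rewrite big_split /= -scaler_suml -rmorph_sum c1 rmorph1 scale1r.
  move=> j; have [_ /weylP[s _ ->] <-] := Sv j.
  have <- : wword g s (lam + ratr k *: - delta g) =
      wword g s lam + ratr k *: - delta g.
    by rewrite linearD linearZ /= linearN /= wword_delta.
  apply: convQ_linear base => _ [_ /weylP[t _ ->] <-].
  by rewrite -wword_cat; exact/orbit_wword/allT.
have steps m x : convQ OW x -> convQ OW (x + ratr (m%:R * k) *: - delta g).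
  elim: m x => [|m IH] x Sx; first by rewrite mul0r rmorph0 scale0r addr0.
  by rewrite -natr1 mulrDl mul1r rmorphD scalerDl addrA; exact/step/IH.
(* [m] is such that [q <= m k]; the successor keeps [m k] positive. *)
move=> Smu q0; pose m := (Num.bound (q / k)).+1.
have qk : 0 <= q / k by rewrite divr_ge0 // ltW.
have mk : 0 < m%:R * k by rewrite mulr_gt0 // ltr0n.
have tb : 0 <= q / (m%:R * k) <= 1.
  rewrite divr_ge0 ?(ltW mk) //= ler_pdivrMr // mul1r -ler_pdivrMr //.
  by apply/ltW/(lt_le_trans (archi_boundP qk)); rewrite ler_nat.
have := convQ_segment Smu (steps m _ Smu) tb.
rewrite scalerDr addrA -scalerDl -rmorphD subrK rmorph1 scale1r scalerA -rmorphM.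
by rewrite divfK ?gt_eqF.
Qed.

(** The coefficient of [Lambda_i] is the value on the i-th coroot; that of [delta] is the value at
    [der], which is minus the 0-th coordinate of [y] because [lam] vanishes there. *)
Lemma weight_hdualQ y : lam (der g) = 0 -> hdualQ (weight y).
Proof.
move=> lam_d; exists (fun i => b i 0 - (X *m y) i 0), (- y ord0 0).
apply: hdual_ext => [i|].
  rewrite weight_coroot add_lfunE sum_lfunE (bigD1 i) //= scale_lfunE LambdaE eqxx.
  rewrite big1 => [|j ji]; last first.
    by rewrite scale_lfunE LambdaE (negPf ji) -[LHS]/(_ * _) mulr0.
  rewrite scale_lfunE delta_coroot scaler0 !addr0.
  by rewrite -[RHS]/(_ * _) mulr1.
rewrite !add_lfunE opp_lfunE lam_d add0r [comb g y _]comb_der.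
rewrite scale_lfunE delta_der sum_lfunE big1 => [|i _]; last first.
  by rewrite scale_lfunE Lambda_d scaler0.
by rewrite add0r rmorphN -[RHS]/(_ * _) mulr1.
Qed.

Lemma dominant_polyhedronE : lam (der g) = 0 ->
  dominant_polyhedron lam =
  minkowski (convQ [set bhat J lam | J in
               [set J : {set 'I_(1 + l)} | J \proper [set: 'I_(1 + l)]%SET]])
            (coneQ (- delta g)).
Proof.
move=> lam_d; have [e aff] := extended_affine (fin_cartanP g) (thetaP g).
apply/seteqP; split=> mu.
  case=> [[_ mu_dom] mu_conv].
  have orbP x : OW x -> exists2 y : 'cV[rat]_(1 + l),
      forall k, 0 <= y k 0 & x = weight y.
    case=> _ /weylP[s _ ->] <-; rewrite wword_lam; exists (aword X b s 0) => //.
    by apply: (aword_ge0 aff) => i; exact: ltW.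
  have [n [c [y [c0 c1 y0 muE]]]] := convQ_weight orbP mu_conv.
  have muP : polyhedron X b (\sum_k c k *: y k).
    split=> i.
      rewrite summxE; apply: sumr_ge0 => k _.
      by rewrite mxE mulr_ge0 // y0.
    by have := mu_dom i; rewrite muE weight_coroot ler0q subr_ge0.
  have ex J : exists z, J \proper [set: 'I_(1 + l)]%SET ->
      [/\ bhat J lam = weight z, supported J z &
          forall j, j \in J -> (X *m z) j 0 = b j 0].
    have [Jp|] := boolP (J \proper [set: 'I_(1 + l)]%SET); last by exists 0.
    by have [z zP] := bhat_weight Jp; exists z.
  have [vertex vP] := choice ex.
  have [p [t [p0 p1 t0 cE]]] : decomposed a vertex (\sum_k c k *: y k).
    apply: (polyhedron_decomposed aff b_gt0) muP => // J Jp.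
      by have [] := vP J Jp.
    by have [] := vP J Jp.
  exists (weight (\sum_(J : {set 'I_(1 + l)} | J \proper [set: 'I_(1 + l)]%SET)
    p J *: vertex J)); last first.
    by exists (ratr t *: - delta g); [exists t | rewrite muE cE weight_marks].
  (* To sum over all subsets, the improper one gets coefficient 0 and the vertex of the empty set as
     default. *)
  pose P J := J \proper [set: 'I_(1 + l)]%SET.
  pose q J := if P J then p J else 0.
  pose v J := if P J then vertex J else vertex finset.set0.
  have q1 : \sum_J q J = 1 by rewrite /q -big_mkcond.
  have -> : \sum_(J | P J) p J *: vertex J = \sum_J q J *: v J.
    rewrite big_mkcond; apply: eq_bigr => J _; rewrite /q /v.
    by case: ifP; rewrite ?scale0r.
  rewrite (weight_sum _ q1); apply: convQ_fin => // [J|J].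
    by rewrite /q; case: ifP.
  have P0 : P finset.set0.
    rewrite /P properE finset.sub0set /=; apply/subsetPn.
    by exists ord0; rewrite !inE.
  rewrite /v; case: ifP => [JP|_]; last first.
    by exists finset.set0 => //; have [] := vP _ P0.
  by exists J => //; have [] := vP _ JP.
case=> x x_conv [_ [q q0 <-] <-].
(* Dominance of [bhat J lam]: on [J] the inequality is an equality; off [J], the coordinates being
   nonnegative and supported on [J], the left side is nonpositive. *)
have bhatP z : [set bhat J lam | J in
    [set J : {set 'I_(1 + l)} | J \proper [set: 'I_(1 + l)]%SET]] z ->
    exists2 y : 'cV[rat]_(1 + l), forall i, (X *m y) i 0 <= b i 0 & z = weight y.
  case=> J /= Jp <-; have [y [-> yJ yb]] := bhat_weight Jp; exists y => // i.
  have [iJ|iJ] := boolP (i \in J); first by rewrite yb.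
  apply: le_trans (ltW (b_gt0 i)); apply: (supported_mul_le0 aff yJ) => //.
  by apply: (supported_ge0 aff Jp yJ) => j jJ; rewrite yb // ltW.
split.
  have [n [c [y [c0 c1 yb ->]]]] := convQ_weight bhatP x_conv.
  rewrite -weight_marks; split; first exact: weight_hdualQ.
  (* The marks are killed by [X], so subtracting a multiple of [delta] preserves dominance. *)
  move=> i; rewrite weight_coroot ler0q subr_ge0 mulmxDr -scalemxAr extq_marks.
  rewrite scaler0 addr0 mulmx_sumr summxE.
  rewrite -[leRHS]mul1r -c1 mulr_suml; apply: ler_sum => k _.
  by rewrite -scalemxAr mxE ler_wpM2l // yb.
(* Each [bhat J lam] lies in the hull of the [W_J]-orbit, hence in that of the [W]-orbit. *)
apply: orbit_recession q0; apply: convQ_idem.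
have [n [c [v [c0 c1 vP ->]]]] := x_conv; exists n, c, v; split=> // k.
have [J /= Jp <-] := vP k; have [m [d [w [d0 d1 wJ ->]]]] := bhat_convQ Jp.
exists m, d, w; split=> // j; have [_ /weylP[s _ ->] <-] := wJ j.
exact/orbit_wword/allT.
Qed.

End DominantPolyhedron.

Theorem proposition3p12 (R : realType) (l : nat)
    (g : untwisted_affine R[i] l) (lambda : hdual g)
    (lambda_dom : dominant_integral lambda)
    (lambda_reg : regular_dominant lambda)
    (lambda_d : lambda (der g) = 0) :
  dominant_polyhedron lambda =
  minkowski
    (convQ [set bhat J lambda | J in
              [set J : {set 'I_(1 + l)} | J \proper [set: 'I_(1 + l)]%SET]])
    (coneQ (- delta g)).
Proof.
have [m mE] := choice lambda_dom.
pose b : 'cV[rat]_(1 + l) := \col_i (m i)%:R.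
have lamE i : lambda (alphav g i) = ratr (b i 0) :> R[i].
  by rewrite mE mxE rmorph_nat.
apply: (dominant_polyhedronE lamE) => // i.
by have := lambda_reg i; rewrite lamE ltr0q.
Qed.
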